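(* Let $\mu$ be a probability measure on $\mathbb{R}^n$ (for which the covariance matrix $\mathrm{Cov}(\mu)$ is defined) such that its entropy $H_\nu(\mu)$ exists with respect to some background measure $\nu$ on $\mathbb{R}^n$. For all $\varepsilon>0$ there exist a probability measure $m$ on some index set $\mathcal{I}$ and a family of probability measures $\{\mu_\theta\}_{\theta\in\mathcal{I}}$ on $\mathbb{R}^n$ such that $$\mu(A)=\int_{\mathcal{I}}\mu_\theta(A)\,dm(\theta)\qquad\text{for all measurable } A\subset\mathbb{R}^n,$$ and such that: - $H_\nu(\mu)-\mathbb{E}_{\theta\sim m}H_\nu(\mu_\theta)\le \mathrm{Tr}(\mathrm{Cov}(\mu))\,\varepsilon$; - $\mathbb{E}_{\theta\sim m}\mathrm{Cov}(\mu_\theta)\preceq \frac{\mathrm{Id}}{\varepsilon}$; - $\mathbb{E}_{\theta\sim m}\mathrm{Tr}\left(\mathrm{Cov}(\mu_\theta)^2\right)\le \frac{\mathrm{Tr}(\mathrm{Cov}(\mu))}{\varepsilon}$.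
   Context: For a measure $\mu$ absolutely continuous with respect to a background measure $\nu$ on $\mathbb{R}^n$, the entropy is $H_\nu(\mu)=-\int_{\mathbb{R}^n}\log\left(\frac{d\mu}{d\nu}\right)d\mu$, whenever the integral converges. The covariance matrix of $\mu$ is $\mathrm{Cov}(\mu)=\int x^{\otimes 2}\,d\mu(x)-\left(\int x\,d\mu(x)\right)^{\otimes 2}$, where $x^{\otimes 2}=xx^T$. $\mathrm{Id}$ is the $n\times n$ identity matrix, $\log$ is the natural logarithm, and $A\preceq B$ means that $B-A$ is positive semidefinite. $\mathbb{E}_{\theta\sim m}$ denotes integration over $\theta$ with respect to $m$. *)

(* Defs.v *)
From HB Require Import structures.
From mathcomp Require Import all_boot all_order all_algebra.
From mathcomp Require Import all_classical all_reals all_analysis measurable_realfun.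

Set Implicit Arguments.
Unset Strict Implicit.
Unset Printing Implicit Defensive.

Import Order.TTheory GRing.Theory Num.Theory.
Import numFieldNormedType.Exports.

Local Open Scope classical_set_scope.
Local Open Scope ring_scope.

Section entropy.
Context d (T : measurableType d) (R : realType).
Implicit Types (nu mu : {measure set T -> \bar R}) (f g : T -> R).

(* f is a version of dmu/dnu.  The library's Radon_Nikodym is only available
   for a sigma-finite nu, whereas here nu is an arbitrary measure; having a
   density entails mu `<< nu (density_dominates). *)
Definition is_density nu mu f : Prop :=
  [/\ measurable_fun setT f, forall x, 0 <= f x &
      forall A, measurable A -> mu A = (\int[nu]_(x in A) (f x)%:E)%E].

Definition density nu mu : T -> R := xget (cst 0) [set f | is_density nu mu f].

(* H_nu(mu) exists: mu has a density with respect to nu and the integral of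
   its logarithm against mu converges absolutely.  The value ln 0 = 0 is
   harmless, a density being mu-almost everywhere positive. *)
Definition has_entropy nu mu : Prop :=
  exists2 f, is_density nu mu f &
    mu.-integrable setT (fun x => (ln (f x))%:E).

(* Meaningful when has_entropy nu mu holds; the choice of the density is then
   immaterial (entropyE). *)
Definition entropy nu mu : R := - \int[mu]_x ln (density nu mu x).

Lemma densityP nu mu f : is_density nu mu f -> is_density nu mu (density nu mu).
Proof. by move=> fP; apply: (@xgetPex _ (cst 0) [set g | is_density nu mu g]); exists f. Qed.

Lemma density_dominates nu mu f : is_density nu mu f -> mu `<< nu.
Proof.
move=> [mf f0 fE]; apply/null_content_dominatesP => A mA nuA0.
rewrite fE//; apply: null_set_integral => //.
by apply/measurable_EFinP; exact: measurable_funTS.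
Qed.

Lemma density_unique nu mu f g : (mu setT < +oo)%E ->
  is_density nu mu f -> is_density nu mu g ->
  ae_eq nu setT (EFin \o f) (EFin \o g).
Proof.
move=> muoo [mf f0 fE] [mg g0 gE]; apply: integral_ae_eq => //.
- apply/integrableP; split; first exact/measurable_EFinP.
  under eq_integral do rewrite /= ger0_norm ?f0//.
  by rewrite -fE.
- exact/measurable_EFinP.
- by move=> E _ mE; rewrite /= -fE// -gE.
Qed.

Lemma entropyE nu mu f : (mu setT < +oo)%E -> is_density nu mu f ->
  entropy nu mu = - \int[mu]_x ln (f x).
Proof.
move=> muoo fP; have gP := densityP fP.
have munu := density_dominates fP.
rewrite /entropy /Rintegral; congr (- fine _).
have [mf _ _] := fP; have [mg _ _] := gP.
apply: ae_eq_integral => //.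
- by apply/measurable_EFinP; exact: measurableT_comp.
- by apply/measurable_EFinP; exact: measurableT_comp.
have h : ae_eq mu setT (EFin \o density nu mu) (EFin \o f).
  exact: (null_dominates_ae_eq measurableT) munu (density_unique muoo gP fP).
by apply: filterS h => x /= /(_ I) [->].
Qed.

End entropy.

(* R^n is n.-tuple R with its product sigma-algebra, i.e. the Borel one. *)
Section covariance_matrix.
Context (R : realType) (n : nat).
Implicit Types mu : {measure set (n.-tuple R) -> \bar R}.

Definition has_cov mu : Prop :=
  (forall i, mu.-integrable setT (fun x => (tnth x i)%:E)) /\
  (forall i j, mu.-integrable setT (fun x => (tnth x i * tnth x j)%:E)).

Definition mean mu : 'cV[R]_n := \col_i \int[mu]_x tnth x i.

Definition second_moment mu : 'M[R]_n :=
  \matrix_(i, j) \int[mu]_x (tnth x i * tnth x j).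

Definition Cov mu : 'M[R]_n := second_moment mu - mean mu *m (mean mu)^T.

End covariance_matrix.

Definition psd (R : realType) (n : nat) (A : 'M[R]_n) : Prop :=
  A^T = A /\ forall u : 'cV[R]_n, 0 <= (u^T *m A *m u) 0 0.

Definition loewner_le (R : realType) (n : nat) (A B : 'M[R]_n) : Prop :=
  psd (B - A).

(* Main.v *)
(* Let Y = t X + G, with X of law mu and G a centered Gaussian vector of
   covariance t Id, and decompose mu into the conditional laws mu_Y of X given Y.

   The expected loss of entropy is the mutual information of X and Y, at most
   t/2 Tr(Cov mu) by Gibbs' inequality against the Gaussian law centered at
   t E[X]; and E Cov(mu_Y) is at most the covariance Id/t of the error of the
   estimator Y/t of X.

   The third bound holds for some t in [eps, 2 eps].  With F(t) = E Tr Cov(mu_Y),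
   the least mean square error in estimating X from Y, and given an independent
   observation h X + G' over an extra time h, correcting the posterior mean
   linearly with gain Cov(mu_Y) yields
     F(t + h) <= F(t) - h E Tr(Cov(mu_Y)^2) + O(h^2),
   where the error term is uniform because the sixth moments of G are bounded.
   If E Tr(Cov(mu_Y)^2) > Tr(Cov mu) / eps on the whole of [eps, 2 eps], then
   iterating from F(eps) < Tr(Cov mu) makes F(2 eps) negative.

   Only the Laplace transform of G is used, so that adding independent
   observations needs no convolution of Gaussian densities. *)
Require Import Defs.
From HB Require Import structures.
From mathcomp Require Import all_boot all_order all_algebra.
From mathcomp Require Import all_classical all_reals all_analysis measurable_realfun.
From mathcomp Require Import ring lra.
Import Order.TTheory GRing.Theory Num.Theory.
Import numFieldNormedType.Exports.
Local Open Scope classical_set_scope.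
Local Open Scope ring_scope.

Set Implicit Arguments.
Unset Strict Implicit.
Unset Printing Implicit Defensive.

(** * Integrals and densities *)

(** The observation is not realised as t X + G. It is a vector [th] on a reference space, reweighted
    by exp(th . x - t |x|^2 / 2) when the signal is x. The posteriors then have explicit densities
    with respect to mu, so the conditional laws form a kernel defined at every observation.

    Adjoining an independent observation multiplies the weights and takes the product of the
    reference spaces. The posterior indexed by the pair depends only on the sum of the two vectors,
    while the improved estimator may use them separately. The index space therefore grows at each
    step, and is quantified existentially.

    The descent in t is discrete: N steps of length h = eps / N accumulate an error of N h^2 D = eps
    h D, with one D valid on [eps, 2 eps]. The strict gap between F(eps) and Tr(Cov mu), produced by
    the best linear estimator, has to absorb this error. The gap closes when Tr(Cov mu) = 0, a case
    settled by a single short step.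

    The interval fits the other two bounds: the factor 1/2 in the entropy loss pays for t <= 2 eps,
    and t >= eps gives Id/t <= Id/eps. *)

Section integrates.
Context d (T : measurableType d) (R : realType).
Implicit Types (mu : {measure set T -> \bar R}) (f g : T -> R) (c k : R).

(** Integrability and value travel together, so that linear combinations and comparisons of real
    integrals carry no finiteness side conditions. *)
Definition integrates mu f c :=
  mu.-integrable setT (EFin \o f) /\ (\int[mu]_x (f x)%:E = c%:E)%E.

Lemma integratesP mu f :
  mu.-integrable setT (EFin \o f) -> integrates mu f (\int[mu]_x f x).
Proof. by move=> fi; split => //; rewrite fineK// integrable_fin_num. Qed.

Lemma integratesE mu f c : integrates mu f c -> \int[mu]_x f x = c.
Proof. by move=> [_ fc]; rewrite /Rintegral fc. Qed.

Lemma integrates_measurable mu f c : integrates mu f c -> measurable_fun setT f.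
Proof. by move=> [/integrableP[/measurable_EFinP]]. Qed.

Lemma eq_integrates mu f g c : f =1 g -> integrates mu f c -> integrates mu g c.
Proof. by move=> /funext ->. Qed.

Lemma integratesD mu f g c k : integrates mu f c -> integrates mu g k ->
  integrates mu (fun x => f x + g x) (c + k).
Proof.
move=> [fi fc] [gi gk]; split; first exact: (integrableD measurableT fi gi).
by rewrite EFinD -fc -gk -(integralD measurableT fi gi).
Qed.

Lemma integratesZ mu f c k : integrates mu f c ->
  integrates mu (fun x => k * f x) (k * c).
Proof.
move=> [fi fc]; split; first exact: (integrableZl measurableT k fi).
by rewrite EFinM -fc -(integralZl measurableT fi).
Qed.

Lemma integratesB mu f g c k : integrates mu f c -> integrates mu g k ->
  integrates mu (fun x => f x - g x) (c - k).
Proof.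
move=> fc /(integratesZ (-1)) gk; rewrite -(mulN1r k).
by apply: eq_integrates (integratesD fc gk) => x; rewrite mulN1r.
Qed.

Lemma integrates0 mu : integrates mu (fun=> 0) 0.
Proof. by split; [exact: integrable0|rewrite integral0]. Qed.

Lemma integrates_sum mu (I : Type) (r : seq I) (P : pred I) (F : I -> T -> R) (C : I -> R) :
  (forall i, P i -> integrates mu (F i) (C i)) ->
  integrates mu (fun x => \sum_(i <- r | P i) F i x) (\sum_(i <- r | P i) C i).
Proof.
move=> FC; elim: r => [|i r IH].
  rewrite big_nil; apply: eq_integrates (integrates0 mu) => x.
  by rewrite big_nil.
rewrite big_cons; case: ifPn => Pi.
  by apply: eq_integrates (integratesD (FC _ Pi) IH) => x; rewrite big_cons Pi.
by apply: eq_integrates IH => x; rewrite big_cons (negbTE Pi).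
Qed.

Lemma integrates_cst mu k : mu setT = 1%E -> integrates mu (fun=> k) k.
Proof.
move=> mu1; split; last by rewrite integral_cst// mu1 mule1.
apply/integrableP; split; first by apply/measurable_EFinP.
by rewrite [ltLHS](_ : _ = `|k%:E| * mu setT)%E;
  [rewrite mu1 mule1 /= ltry|exact: (integral_cst mu measurableT `|k%:E|%E)].
Qed.

Lemma le_integrates mu f g c k : integrates mu f c -> integrates mu g k ->
  (forall x, f x <= g x) -> c <= k.
Proof.
move=> [fi fc] [gi gk] fg; rewrite -lee_fin -fc -gk.
by apply: le_integral => // x _; rewrite lee_fin.
Qed.

Lemma dominated_integrates mu f g k : measurable_fun setT f ->
  (forall x, `|f x| <= g x) -> integrates mu g k ->
  integrates mu f (\int[mu]_x f x).
Proof.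
move=> mf fg [gi _]; apply: integratesP; apply: (le_integrable _ _ _ gi) => //.
  exact/measurable_EFinP.
by move=> x _ /=; rewrite lee_fin (le_trans (fg x))// ler_norm.
Qed.

Lemma ge0_integrates mu f : measurable_fun setT f -> (forall x, 0 <= f x) ->
  (\int[mu]_x (f x)%:E < +oo)%E -> integrates mu f (\int[mu]_x f x).
Proof.
move=> mf f0 foo; apply: integratesP; apply/integrableP; split.
  exact/measurable_EFinP.
by under eq_integral do rewrite /= ger0_norm ?f0//.
Qed.

Lemma integrates_ge0_le mu f (k : R) : measurable_fun setT f ->
  (forall x, 0 <= f x) -> (\int[mu]_x (f x)%:E <= k%:E)%E ->
  exists2 c, integrates mu f c & 0 <= c <= k.
Proof.
move=> mf f0 fk; have fi : integrates mu f (\int[mu]_x f x).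
  by apply: ge0_integrates => //; rewrite (le_lt_trans fk)// ltry.
exists (\int[mu]_x f x) => //; rewrite -!lee_fin -fi.2 fk andbT.
by apply: integral_ge0 => x _; rewrite lee_fin.
Qed.

Lemma integrates_unique mu f c k : integrates mu f c -> integrates mu f k -> c = k.
Proof. by move=> [_ fc] [_ fk]; apply/EFin_inj; rewrite -fc -fk. Qed.

End integrates.

Section density.
Context d (T : measurableType d) (R : realType).
Implicit Types (mu nu : {measure set T -> \bar R}) (p q f : T -> R).

Import HBNNSimple.

(** For indicators this is the definition of a density; linearity extends it to simple functions,
    and monotone convergence along [nnsfun_approx] to all nonnegative measurable functions. *)
Lemma ge0_integral_density mu nu p (f : T -> \bar R) : is_density mu nu p ->
  measurable_fun setT f -> (forall x, 0 <= f x)%E ->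
  (\int[nu]_x f x = \int[mu]_x (f x * (p x)%:E))%E.
Proof.
move=> [mp p0 pE] mf f0; apply/esym.
pose h := nnsfun_approx measurableT mf.
have mh n : measurable_fun setT (EFin \o h n) by exact/measurable_EFinP.
have mp' : measurable_fun setT (EFin \o p) by exact/measurable_EFinP.
have hf x : (h n x)%:E @[n --> \oo] --> f x by apply: cvg_nnsfun_approx => //= y _; exact: f0.
have hnd x : {homo (h ^~ x) : a b / (a <= b)%N >-> a <= b}.
  by move=> a b ab; exact/lefP/nd_nnsfun_approx.
have -> : (\int[nu]_x f x = limn (fun n => \int[nu]_x (h n x)%:E))%E.
  rewrite -monotone_convergence//.
  - by apply: eq_integral => x _; apply/esym/cvg_lim.
  - by move=> n x _; rewrite lee_fin.
  - by move=> x _ a b ab; rewrite lee_fin; exact: hnd.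
have -> : (\int[mu]_x (f x * (p x)%:E)
    = limn (fun n => \int[mu]_x ((h n x)%:E * (p x)%:E)))%E.
  rewrite -monotone_convergence//.
  - apply: eq_integral => x _; apply/esym/cvg_lim => //.
    exact: cvgeZr.
  - by move=> n; exact: (emeasurable_funM (mh n) mp').
  - by move=> n x _; rewrite mule_ge0 ?lee_fin.
  - by move=> x _ a b ab; rewrite lee_wpmul2r ?lee_fin//; exact: hnd.
congr (limn _); apply/funext => n.
have mind r : measurable_fun setT (fun x => (r * \1_(h n @^-1` [set r]) x)%:E).
  by apply/measurable_EFinP; exact: measurable_funM.
transitivity (\int[mu]_x (\sum_(y \in range (h n))
    ((y * \1_(h n @^-1` [set y]) x)%:E * (p x)%:E)))%E.
  apply: eq_integral => x _; rewrite [in LHS]fimfunE -fsumEFin//.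
  by rewrite ge0_mule_fsuml// => y; exact: nnfun_muleindic_ge0.
rewrite ge0_integral_fsum//; last 2 first.
- by move=> y; exact: emeasurable_funM.
- by move=> y x _; rewrite mule_ge0 ?lee_fin ?p0//; exact: nnfun_muleindic_ge0.
transitivity (\int[nu]_x (\sum_(y \in range (h n))
    (y * \1_(h n @^-1` [set y]) x)%:E))%E; last first.
  by apply: eq_integral => x _; rewrite [in RHS]fimfunE -fsumEFin.
rewrite ge0_integral_fsum//; last by move=> y x _; exact: nnfun_muleindic_ge0.
apply: eq_fsbigr => r rhn.
have r0 : 0 <= r by move: rhn; rewrite inE => -[x _ <-].
under [RHS]eq_integral do rewrite EFinM.
rewrite integralZl_indic_nnsfun//.
under eq_integral do rewrite EFinM -muleA.
have mr : measurable (h n @^-1` [set r]) by [].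
rewrite ge0_integralZl//; last 2 first.
- by apply: emeasurable_funM => //; exact/measurable_EFinP.
- by move=> x _; rewrite mule_ge0 ?lee_fin.
under eq_integral do rewrite muleC.
rewrite (eq_integral ((EFin \o p) \_ (h n @^-1` [set r]))); last first.
  by move=> x _; rewrite epatch_indic.
by rewrite -integral_mkcond -pE// integral_indic// setIT.
Qed.

Lemma integrable_density mu nu p f : is_density mu nu p -> measurable_fun setT f ->
  mu.-integrable setT (fun x => (f x * p x)%:E) <->
  nu.-integrable setT (EFin \o f).
Proof.
move=> pP mf; have [mp p0 pE] := pP.
have E : (\int[nu]_x `|(f x)%:E| = \int[mu]_x `|(f x * p x)%:E|)%E.
  rewrite (ge0_integral_density pP)//; last first.
    by apply: measurableT_comp => //; exact/measurable_EFinP.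
  by apply: eq_integral => x _; rewrite EFinM abseM (@gee0_abs _ (p x)%:E)// lee_fin.
split=> /integrableP[m1 foo]; apply/integrableP; split.
- exact/measurable_EFinP.
- by rewrite E.
- by apply/measurable_EFinP; exact: measurable_funM.
- by rewrite -E.
Qed.

Lemma integrates_density mu nu p f c : is_density mu nu p -> measurable_fun setT f ->
  integrates mu (fun x => f x * p x) c <-> integrates nu f c.
Proof.
move=> pP mf; have [mp p0 pE] := pP.
suff E : nu.-integrable setT (EFin \o f) ->
    (\int[nu]_x (f x)%:E = \int[mu]_x (f x * p x)%:E)%E.
  split=> -[fi fc]; split.
  - exact/(integrable_density pP mf).
  - by rewrite E//; exact/(integrable_density pP mf).
  - exact/(integrable_density pP mf).
  - by rewrite -E.
move=> fi; have fi' := (integrable_density pP mf).2 fi.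
rewrite integralE [RHS]integralE.
have mf' : measurable_fun setT (EFin \o f) by exact/measurable_EFinP.
rewrite !(ge0_integral_density pP)//; [|exact: measurable_funeneg|exact: measurable_funepos].
congr (_ - _)%E; apply: eq_integral => x _.
  by rewrite !funeposE/= -!EFin_max -EFinM maxr_pMl// mul0r.
by rewrite !funenegE/= -!EFin_max -EFinM maxr_pMl// mul0r mulNr.
Qed.

Lemma is_density_comp mu nu (la : {measure set T -> \bar R}) p q :
  is_density mu nu p -> is_density nu la q -> is_density mu la (fun x => p x * q x).
Proof.
move=> pP [mq q0 qE]; have [mp p0 pE] := pP; split.
- exact: measurable_funM.
- by move=> x; rewrite mulr_ge0.
- move=> A mA; rewrite qE// integral_mkcond (ge0_integral_density pP); last 2 first.
  + by apply/(measurable_restrictT _ mA).1; apply: measurable_funTS; exact/measurable_EFinP.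
  + by move=> x; rewrite patchE; case: ifPn; rewrite ?lee_fin.
  rewrite [RHS]integral_mkcond; apply: eq_integral => x _.
  by rewrite !patchE; case: ifPn; rewrite ?mul0e// EFinM muleC.
Qed.

End density.

(** * Measures and kernels built from densities *)

Section weighted.
Context d (T : measurableType d) (R : realType).
Variables (mu : {measure set T -> \bar R}) (p : T -> R).
Hypotheses (mp : measurable_fun setT p) (p0 : forall x, 0 <= p x).

(** The two proofs are arguments so that the measure structure can be attached to the function
    itself. *)
Definition weighted of measurable_fun setT p & (forall x, 0 <= p x) :=
  fun A : set T => (\int[mu]_(x in A) (p x)%:E)%E.

Local Notation nu := (weighted mp p0).

Let weighted0 : nu set0 = 0%E.
Proof. by rewrite /weighted integral_set0. Qed.

Let weighted_ge0 A : (0 <= nu A)%E.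
Proof. by apply: integral_ge0 => x _; rewrite lee_fin. Qed.

Let weighted_sigma_additive : semi_sigma_additive nu.
Proof.
move=> A mA tA mUA; rewrite /weighted ge0_integral_bigcup//.
- by apply: is_cvg_ereal_nneg_natsum_cond => n _ _; exact: weighted_ge0.
- by apply: measurable_funTS; exact/measurable_EFinP.
- by move=> x _; rewrite lee_fin.
Qed.

HB.instance Definition _ := isMeasure.Build _ _ _
  nu weighted0 weighted_ge0 weighted_sigma_additive.

Lemma is_density_weighted : is_density mu nu p.
Proof. by split. Qed.

End weighted.

Lemma probability_with_density d (T : measurableType d) (R : realType)
    (mu : {measure set T -> \bar R}) (p : T -> R) :
  measurable_fun setT p -> (forall x, 0 <= p x) ->
  (\int[mu]_x (p x)%:E = 1)%E -> exists nu : probability T R, is_density mu nu p.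
Proof.
move=> mp p0 p1; pose nu := [the {measure set T -> \bar R} of weighted mu mp p0].
pose H := @Measure_isProbability.Build _ _ R nu p1.
pose P : probability T R := HB.pack (Measure.sort nu) H.
by exists P; exact: is_density_weighted.
Qed.

Section weighted_kernel.
Context d d' (X : measurableType d) (Y : measurableType d') (R : realType).
Variables (mu : probability Y R) (w : X -> Y -> R).
Hypotheses (mw : measurable_fun setT (fun z => w z.1 z.2)) (w0 : forall x y, 0 <= w x y).
Hypothesis (w1 : forall x, (\int[mu]_y (w x y)%:E = 1)%E).

Let mw2 x : measurable_fun setT (w x).
Proof. exact: (measurableT_comp mw (measurable_pair1 x)). Qed.

Definition weighted_kernel (x : X) : {measure set Y -> \bar R} :=
  weighted mu (mw2 x) (w0 x).

Let measurable_weighted_kernel U : measurable U ->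
  measurable_fun setT (weighted_kernel ^~ U).
Proof.
move=> mU.
rewrite [X in measurable_fun _ X](_ : _ = fun x => \int[mu]_y (w x y * \1_U y)%:E)%E; last first.
  apply/funext => x; rewrite /weighted_kernel/= /weighted integral_mkcond.
  apply: eq_integral => y _; rewrite patchE indicE.
  by case: ifPn => _; rewrite ?mulr1 ?mulr0.
apply: (@measurable_fun_fubini_tonelli_F _ _ _ _ _ mu
  (fun z => (w z.1 z.2 * \1_U z.2)%:E)).
  apply/measurable_EFinP; apply: measurable_funM => //.
    by apply: measurableT_comp => //; exact: measurable_indic.
  by move=> x; rewrite lee_fin mulr_ge0.
Qed.

HB.instance Definition _ :=
  isKernel.Build _ _ _ _ R weighted_kernel measurable_weighted_kernel.

HB.instance Definition _ :=
  @Kernel_isProbability.Build _ _ _ _ _ weighted_kernel w1.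

Lemma kernel_with_density :
  exists k : R.-pker X ~> Y, forall x, is_density mu (k x) (w x).
Proof. by exists weighted_kernel => x; exact: is_density_weighted. Qed.

End weighted_kernel.

(** * Moments of Gaussian variables *)

Section subgaussian_moments.
Context (R : realType).

Lemma expR_ge_partial (n : nat) (x : R) : 0 <= x ->
  \sum_(0 <= i < n) exp_coeff x i <= expR x.
Proof.
move=> x0; apply: nondecreasing_cvgn_le; last exact: is_cvg_series_exp_coeff.
apply: nondecreasing_series => i _ _; exact: exp_coeff_ge0.
Qed.

(** With y = 2 z and a = exp z, the difference of the right side and 2 is (a - 1/a)^2. Moreover a >=
    q = 1 + z + z^2/2 for z >= 0, and q - 1/q >= 2 z because q^2 - 2 z q - 1 = z^4/4. *)
Lemma expR_cosh_ge (y : R) : 2 + y ^+ 2 <= expR y + expR (- y).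
Proof.
wlog y0 : y / 0 <= y => [hw|].
  have [|/ltW y0] := leP 0 y; first exact: hw.
  have := hw (- y); rewrite opprK oppr_ge0 sqrrN => /(_ y0).
  by rewrite [expR _ + _]addrC.
set z := y / 2; have yE : y = z + z by rewrite /z; field.
have z0 : 0 <= z by rewrite divr_ge0.
set a := expR z; have a0 : 0 < a := expR_gt0 _.
have az : 1 + z + z ^+ 2 / 2 <= a.
  apply: le_trans (expR_ge_partial 3 z0).
  rewrite !big_nat_recr//= big_geq// /exp_coeff/= !factS fact0 expr0 expr1.
  by rewrite !muln1 add0r !divr1.
set q := 1 + z + z ^+ 2 / 2 in az.
have q1 : 1 <= q by rewrite /q -addrA lerDl addr_ge0// divr_ge0// sqr_ge0.
have q0 : 0 < q by apply: lt_le_trans q1.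
have h : 2 * z <= a - a^-1.
  apply: (@le_trans _ _ (q - q^-1)); last first.
    by apply: lerB => //; rewrite lef_pV2.
  rewrite -(ler_pM2r q0) mulrBl mulVf ?gt_eqF//.
  suff : 0 <= z ^+ 4 / 4 by rewrite /q; nra.
  by rewrite divr_ge0// exprn_even_ge0.
have {h} : (2 * z) ^+ 2 <= (a - a^-1) ^+ 2 by rewrite lerXn2r// ?nnegrE; nra.
rewrite yE expRN expRD -/a sqrrB mulfV ?gt_eqF// invfM -!expr2 exprVn; nra.
Qed.

(** 720 is 6!: for y >= 0 the sixth term of the exponential series already suffices. *)
Lemma expR_sixth_power (y : R) : y ^+ 6 <= 720 * (expR y + expR (- y)).
Proof.
wlog y0 : y / 0 <= y => [hw|].
  have [|/ltW y0] := leP 0 y; first exact: hw.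
  have := hw (- y); rewrite opprK oppr_ge0 => /(_ y0).
  by rewrite [expR _ + _]addrC -[X in X ^+ 6]mulN1r exprMn -signr_odd/= expr0 mul1r.
have := @expR_ge1Dxn R y 5 y0; rewrite (_ : 6`!%:R = 720) => [|//].
by have := expR_ge0 (- y); lra.
Qed.

End subgaussian_moments.

Section gaussian_moments.
Context d (T : measurableType d) (R : realType) (P : {measure set T -> \bar R}).
Hypothesis P1 : P setT = 1%E.
Variables (v : T -> R) (sg : R).
Hypotheses (mv : measurable_fun setT v) (sg0 : 0 <= sg).
Hypothesis mgf : forall s : R,
  (\int[P]_x (expR (s * v x))%:E = (expR (s ^+ 2 * sg / 2))%:E)%E.

Let mgf_integrates s :
  integrates P (fun x => expR (s * v x)) (expR (s ^+ 2 * sg / 2)).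
Proof.
split => //; apply/integrableP; split.
  by apply/measurable_EFinP; apply: measurableT_comp => //; exact: measurable_funM.
by under eq_integral do rewrite /= ger0_norm ?expR_ge0//; rewrite mgf ltry.
Qed.

Let cosh_integrates s : integrates P
  (fun x => expR (s * v x) + expR (- (s * v x))) (2 * expR (s ^+ 2 * sg / 2)).
Proof.
have := integratesD (mgf_integrates s) (mgf_integrates (- s)).
rewrite sqrrN -mulr2n mulr_natl.
by apply: eq_integrates => x; rewrite mulNr.
Qed.

(** Integrating [expR_cosh_ge] at s v gives 2 + s^2 c <= 2 exp(s^2 sg / 2), and comparison at order
    s^2 gives c <= sg. A single small s replaces the limit. *)
Lemma mgf_sqr_integrates : exists2 c, integrates P (fun x => v x ^+ 2) c & c <= sg.
Proof.
have mv2 : measurable_fun setT (fun x => v x ^+ 2) by exact: measurable_funX.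
have hi : integrates P (fun x => v x ^+ 2) (\int[P]_x (v x ^+ 2)).
  apply: (dominated_integrates mv2) (cosh_integrates 1) => x.
  rewrite mul1r ger0_norm ?sqr_ge0//.
  by apply: le_trans (expR_cosh_ge _); rewrite lerDr.
exists (\int[P]_x (v x ^+ 2)) => //; set c := Rintegral _ _ _ in hi *.
have key s : 2 + s ^+ 2 * c <= 2 * expR (s ^+ 2 * sg / 2).
  have := integratesD (integrates_cst 2 P1) (integratesZ (s ^+ 2) hi).
  move/le_integrates; apply; first exact: cosh_integrates.
  by move=> x; rewrite -exprMn; exact: expR_cosh_ge.
have c0 : 0 <= c by apply: Rintegral_ge0 => x _; exact: sqr_ge0.
rewrite leNgt; apply/negP => sgc.
have {}c0 : 0 < c by apply: le_lt_trans sgc.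
(* the test value of s makes r := s^2 sg/2 smaller than 1 - sg/c *)
set k := (c - sg) / (c * (sg + 1)).
have cs0 : 0 < c * (sg + 1) by rewrite mulr_gt0// ltr_wpDl.
have k0 : 0 < k by rewrite divr_gt0// subr_gt0.
have := key (Num.sqrt k); rewrite sqr_sqrtr ?(ltW k0)// => hk.
set r := k * sg / 2 in hk.
have kE : k * (c * (sg + 1)) = c - sg by rewrite /k divfK// gt_eqF.
have r0 : 0 <= r by rewrite divr_ge0// mulr_ge0// ltW.
have r1 : r * c < c - sg by rewrite -kE /r; nra.
have rl1 : r < 1 by rewrite -(ltr_pM2r c0) mul1r (lt_le_trans r1)// lerBlDr lerDl.
have er : expR r * (1 - r) <= 1.
  by rewrite -[leRHS](expRxMexpNx_1 r) ler_wpM2l ?expR_ge0//; exact: expR_ge1Dx.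
have : (2 + k * c) * (1 - r) <= 2.
  have r2 : 0 <= 1 - r by lra.
  have := ler_wpM2r r2 hk; lra.
(* As 2 r = k sg, the preceding inequality says that this quantity is nonpositive. *)
have : 0 < k * (c * (1 - r) - sg) by rewrite mulr_gt0//; nra.
rewrite /r; nra.
Qed.

(** Integrating 1 + s v <= exp(s v) gives s c <= exp(s^2 sg / 2) - 1, which is O(s^2). Since s may
    have either sign, c = 0. *)
Lemma mgf_mean : integrates P v 0.
Proof.
have [c2 v2 _] := mgf_sqr_integrates.
have hi : integrates P v (\int[P]_x v x).
  apply: (dominated_integrates mv) (integratesD (integrates_cst 1 P1) v2) => x.
  have [v0|/ltW v0] := leP 0 (v x); [rewrite ger0_norm//|rewrite ler0_norm//]; nra.
suff -> : 0 = \int[P]_x v x by [].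
set c := Rintegral _ _ _ in hi *.
have key s : s * c <= expR (s ^+ 2 * sg / 2) - 1.
  rewrite lerBrDl.
  have := integratesD (integrates_cst 1 P1) (integratesZ s hi).
  move/le_integrates; apply; first exact: mgf_integrates.
  by move=> x; exact: expR_ge1Dx.
have er (r : R) : 0 <= r -> r <= 1/2 -> expR r - 1 <= 2 * r.
  move=> r0 r1; have : expR r * (1 - r) <= 1.
    by rewrite -[leRHS](expRxMexpNx_1 r) ler_wpM2l ?expR_ge0//; exact: expR_ge1Dx.
  by move=> h; have := expR_gt0 r; nra.
have K s : s ^+ 2 * (sg + 1) <= 1 -> s * c <= s ^+ 2 * (sg + 1).
  move=> s1; have s0 := sqr_ge0 s.
  have ssg : 0 <= s ^+ 2 * sg by rewrite mulr_ge0.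
  have := key s; have := er (s ^+ 2 * sg / 2); lra.
set N := sg + 1 in K; have N0 : 1 <= N by rewrite lerDr.
apply/esym/eqP; rewrite -normr_eq0; apply/negPn/negP => cn0.
have cp : 0 < `|c| by rewrite lt0r cn0 normr_ge0.
(* The sign makes s c = u |c|. The size u is small enough for [K] to apply, and satisfies u N < |c|,
   which contradicts the resulting u |c| <= u^2 N. *)
set s := Num.sg c * (`|c| / (2 * N * (1 + `|c|))).
have D0 : 0 < 2 * N * (1 + `|c|) by nra.
set u := `|c| / _ in s.
have uE : u * (2 * N * (1 + `|c|)) = `|c| by rewrite /u divfK// gt_eqF.
have u0 : 0 < u by rewrite divr_gt0.
have s2 : s ^+ 2 = u ^+ 2.
  by rewrite /s exprMn sqr_sg -normr_eq0 cn0 mul1r.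
have sc : s * c = u * `|c| by rewrite /s mulrAC [in RHS]normrEsg mulrC.
have uN : u * N < `|c|.
  suff : u * N * 2 <= `|c| by nra.
  by rewrite -[leRHS]uE; nra.
have uN1 : u * N <= 1 /\ u <= 1.
  have : u * N * 2 * (1 + `|c|) = `|c| by rewrite -[RHS]uE; ring.
  move=> h; have uN0 : 0 < u * N by nra.
  by split; nra.
have h : u ^+ 2 * N <= 1 by rewrite expr2 -mulrA; nra.
have h2 : u * (u * N) < u * `|c| by rewrite ltr_pM2l.
by have := K s; rewrite s2 sc => /(_ h); lra.
Qed.

Lemma mgf_sixth_integrates : exists2 c,
  integrates P (fun x => v x ^+ 6) c & c <= 1440 * expR (sg / 2).
Proof.
have := integratesZ 720 (cosh_integrates 1); rewrite expr1n mul1r => hi.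
have h x : v x ^+ 6 <= 720 * (expR (1 * v x) + expR (- (1 * v x))).
  by rewrite mul1r expR_sixth_power.
have v6 : integrates P (fun x => v x ^+ 6) (\int[P]_x (v x ^+ 6)).
  apply: (dominated_integrates _ _ hi) => [|x].
    exact: measurable_funX.
  by rewrite ger0_norm// exprn_even_ge0.
exists (\int[P]_x (v x ^+ 6)) => //.
by rewrite (le_trans (le_integrates v6 hi h))// mulrA -natrM.
Qed.

End gaussian_moments.

(** * Disintegration *)

Section disintegration.
Context dA dB dC (A : measurableType dA) (B : measurableType dB)
  (C : measurableType dC) (R : realType).
Variables (m : probability A R) (k : R.-pker A ~> B)
  (J : {measure set C -> \bar R}) (e : A * B -> C).
Hypothesis me : measurable_fun setT e.

Lemma measurable_kernel_integral (F : A * B -> \bar R) :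
  measurable_fun setT F ->
  measurable_fun setT (fun a => \int[k a]_b F (a, b))%E.
Proof.
move=> mF; rewrite [X in measurable_fun _ X](_ : _ = fun a =>
    \int[k a]_b F^\+ (a, b) - \int[k a]_b F^\- (a, b))%E; last first.
  apply/funext => a; rewrite integralE; congr (_ - _)%E.
    by apply: eq_integral => b _; rewrite !funeposE.
  by apply: eq_integral => b _; rewrite !funenegE.
apply: emeasurable_funB.
- apply: (measurable_fun_integral_finite_kernel (F^\+)%E k) => //.
  exact: measurable_funepos.
- apply: (measurable_fun_integral_finite_kernel (F^\-)%E k) => //.
  exact: measurable_funeneg.
Qed.

Lemma measurable_kernel_Rintegral (F : A * B -> R) :
  measurable_fun setT F -> measurable_fun setT (fun a => \int[k a]_b F (a, b)).
Proof.
move=> mF; apply: measurableT_comp => //.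
by apply: (measurable_kernel_integral (F := EFin \o F)); exact/measurable_EFinP.
Qed.

(** [e] will be the identity or the swap of the two coordinates, so that both conditioning on the
    observation and conditioning on the signal are instances. *)
Hypothesis Jmk : forall G : C -> \bar R, measurable_fun setT G ->
  (forall c, 0 <= G c)%E ->
  (\int[J]_c G c = \int[m]_a \int[k a]_b G (e (a, b)))%E.

Variables (G : C -> R) (c : R).
Hypothesis Gc : integrates J G c.

Let mG : measurable_fun setT (EFin \o G).
Proof. by case: Gc => /integrableP[]. Qed.

Let kG a := (\int[k a]_b (G (e (a, b)))%:E)%E.

Let mkG : measurable_fun setT kG.
Proof.
apply: (measurable_kernel_integral (F := fun z => (G (e z))%:E)).
exact: measurableT_comp mG me.
Qed.

Let part (H : C -> \bar R) : measurable_fun setT H -> (forall c, 0 <= H c)%E ->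
  (forall c, H c <= `|(G c)%:E|)%E ->
  m.-integrable setT (fun a => \int[k a]_b H (e (a, b)))%E.
Proof.
move=> mH H0 HG; apply/integrableP; split.
  apply: (measurable_kernel_integral (F := fun z => H (e z))).
  exact: measurableT_comp mH me.
under eq_integral do rewrite gee0_abs ?integral_ge0//.
rewrite -Jmk//; case: Gc => /integrableP[_ + _]; apply: le_lt_trans.
by apply: ge0_le_integral => //; exact: measurableT_comp.
Qed.

Let kGE a : kG a =
  (\int[k a]_b (EFin \o G)^\+ (e (a, b)) - \int[k a]_b (EFin \o G)^\- (e (a, b)))%E.
Proof.
rewrite /kG integralE; congr (_ - _)%E.
  by apply: eq_integral => b _; rewrite !funeposE.
by apply: eq_integral => b _; rewrite !funenegE.
Qed.

Let ipos : m.-integrable setT (fun a => \int[k a]_b (EFin \o G)^\+ (e (a, b)))%E.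
Proof.
apply: part => //; first exact: measurable_funepos.
by move=> x; rewrite funeposE ge_max lee_abs abse_ge0.
Qed.

Let ineg : m.-integrable setT (fun a => \int[k a]_b (EFin \o G)^\- (e (a, b)))%E.
Proof.
apply: part => //; first exact: measurable_funeneg.
by move=> x; rewrite funenegE ge_max -abseN lee_abs abse_ge0.
Qed.

Let ikG : m.-integrable setT kG.
Proof. by rewrite (funext kGE); exact: integrableB. Qed.

Lemma ae_integrable_disintegration :
  {ae m, forall a, (k a).-integrable setT (fun b => (G (e (a, b)))%:E)}.
Proof.
have := integrable_ae measurableT (part (measurableT_comp (@abse_measurable R _) mG)
  (fun=> abse_ge0 _) (fun=> lexx _)).
apply: filterS => a /(_ I) afin; apply/integrableP; split.
  exact: (measurableT_comp (measurableT_comp mG me) (measurable_pair1 a)).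
by rewrite -ge0_fin_numE ?integral_ge0.
Qed.

(** The inner integral is finite for almost every [a]; elsewhere its real version takes a default
    value, which does not affect the outer integral. *)
Lemma integrates_disintegration :
  integrates m (fun a => \int[k a]_b G (e (a, b))) c.
Proof.
have H : ae_eq m setT kG (fun a => (\int[k a]_b G (e (a, b)))%:E).
  by apply: filterS (integrable_ae measurableT ikG) => a afin aT; rewrite fineK// afin.
have mR : measurable_fun setT (fun a => (\int[k a]_b G (e (a, b)))%:E).
  by apply/measurable_EFinP; apply: measurableT_comp.
split.
  apply: (le_integrable _ mR _ ikG) => // a _.
  by rewrite /Rintegral /kG; case: (\int[k a]_b _)%E => [r| |] //=; rewrite normr0 leey.
rewrite -(ae_eq_integral _ _ _ _ _ H)//.
under eq_integral do rewrite kGE.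
rewrite integralB// -!Jmk//; last 2 first.
- exact: measurable_funeneg.
- exact: measurable_funepos.
by case: Gc => _ <-; rewrite [RHS]integralE.
Qed.

End disintegration.

(** If the integral vanished, f would vanish outside a null set; as f is nowhere zero, that null set
    would be the whole space. *)
Lemma integral_gt0 d (T : measurableType d) (R : realType) (P : probability T R)
    (f : T -> R) : P.-integrable setT (EFin \o f) -> (forall x, 0 < f x) ->
  0 < \int[P]_x f x.
Proof.
move=> fi f0; rewrite lt0r Rintegral_ge0 ?andbT//; last by move=> x _; exact: ltW.
apply/negP => /eqP fi0.
have : ae_eq P setT (EFin \o f) (cst 0%E).
  apply/(ae_eq_integral_abs P measurableT); first by case/integrableP : fi.
  under eq_integral do rewrite /= gtr0_norm ?f0//.
  by rewrite (integratesP fi).2 fi0.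
move=> [N [mN N0 NP]]; have NT : N = setT.
  apply/seteqP; split => // x _; apply: NP => /= /(_ I) [] /eqP.
  by rewrite gt_eqF.
by have := probability_setT P; rewrite -NT N0 => /eqP; rewrite eq_sym onee_eq0.
Qed.

Lemma measurable_funV_gt0 d (T : measurableType d) (R : realType) (f : T -> R) :
  measurable_fun setT f -> (forall x, 0 < f x) ->
  measurable_fun setT (fun x => (f x)^-1).
Proof.
move=> mf f0; rewrite (_ : (fun x => _) = fun x => expR (- ln (f x))).
  apply: measurableT_comp => //; apply: measurableT_comp => //.
  exact: (measurableT_comp (@measurable_ln R) mf).
by apply/funext => x; rewrite expRN lnK// posrE.
Qed.

(** * Bayes' rule for a channel given by densities *)

Section channel.
Context dA dB (A : measurableType dA) (B : measurableType dB) (R : realType).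
Variables (ga : probability A R) (mu : probability B R) (w : A -> B -> R).

(* w a b is the density at a, with respect to ga, of the law of the observation
   when the signal is b. *)
Definition channel :=
  [/\ measurable_fun setT (fun z => w z.1 z.2), forall a b, 0 < w a b,
      forall a, mu.-integrable setT (EFin \o w a) &
      forall b, (\int[ga]_a (w a b)%:E = 1)%E].

Definition evidence a : R := \int[mu]_b w a b.

Hypothesis wP : channel.

Let mw : measurable_fun setT (fun z => w z.1 z.2). Proof. by case: wP. Qed.
Let w0 a b : 0 < w a b. Proof. by case: wP. Qed.
Let wi a : mu.-integrable setT (EFin \o w a). Proof. by case: wP. Qed.
Let w1 b : (\int[ga]_a (w a b)%:E = 1)%E. Proof. by case: wP. Qed.

Let mwE : measurable_fun setT (fun z => (w z.1 z.2)%:E).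
Proof. exact/measurable_EFinP. Qed.

Lemma evidence_gt0 a : 0 < evidence a.
Proof. exact: (integral_gt0 (wi a) (w0 a)). Qed.

Lemma evidenceE a : (evidence a)%:E = (\int[mu]_b (w a b)%:E)%E.
Proof. by rewrite (integratesP (wi a)).2. Qed.

Lemma measurable_evidence : measurable_fun setT evidence.
Proof.
apply: measurableT_comp => //.
apply: (@measurable_fun_fubini_tonelli_F _ _ _ _ _ mu _ mwE) => z.
by rewrite lee_fin ltW.
Qed.

Let evidence1 : (\int[ga]_a (evidence a)%:E = 1)%E.
Proof.
under eq_integral do rewrite evidenceE.
rewrite (@fubini_tonelli _ _ _ _ _ ga mu (fun z => (w z.1 z.2)%:E))//=; last first.
  by move=> z; rewrite lee_fin ltW.
under eq_integral do rewrite w1.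
by rewrite integral_cst// mul1e; exact: probability_setT.
Qed.

(** Bayes' rule: [m] is the law of the observation and [post a] the conditional law of the signal
    given the observation [a]. *)
Definition is_posterior (m : probability A R) (post : R.-pker A ~> B) :=
  is_density ga m evidence /\
  forall a, is_density mu (post a) (fun b => w a b / evidence a).

Lemma posterior_exists : exists m post, is_posterior m post.
Proof.
have [m mP] := @probability_with_density _ _ _ ga evidence measurable_evidence
  (fun a => ltW (evidence_gt0 a)) evidence1.
have [] := @kernel_with_density _ _ A B R mu (fun a b => w a b / evidence a).
- apply: measurable_funM => //.
  exact: (measurableT_comp (measurable_funV_gt0 measurable_evidence evidence_gt0)).
- by move=> a b; rewrite divr_ge0// ltW// evidence_gt0.
- move=> a; have [_] := integratesZ (evidence a)^-1 (integratesP (wi a)).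
  rewrite mulVf ?gt_eqF ?evidence_gt0// => <-.
  by apply: eq_integral => b _; rewrite mulrC.
- by move=> post postP; exists m, post.
Qed.

Lemma observation_exists :
  exists k : R.-pker B ~> A, forall b, is_density ga (k b) (w ^~ b).
Proof.
apply: kernel_with_density => //.
- exact: measurableT_comp mw (@measurable_swap _ _ _ _).
- by move=> b a; rewrite ltW.
Qed.

Lemma joint_exists :
  exists J : probability (A * B)%type R, is_density (ga \x mu)%E J (fun z => w z.1 z.2).
Proof.
apply: probability_with_density => //; first by move=> z; rewrite ltW.
rewrite fubini_tonelli1//; last by move=> z; rewrite lee_fin ltW.
rewrite -evidence1; apply: eq_integral => a _.
by rewrite evidenceE.
Qed.

Section joint.
Variables (m : probability A R) (post : R.-pker A ~> B) (k : R.-pker B ~> A)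
  (J : probability (A * B)%type R).
Hypotheses (mpostP : is_posterior m post)
  (kP : forall b, is_density ga (k b) (w ^~ b))
  (JP : is_density (ga \x mu)%E J (fun z => w z.1 z.2)).

(** Tonelli, integrating the signal first: the density [evidence] of [m] cancels the normalisation
    of the posterior. The other order gives [observation_joint]. *)
Lemma posterior_joint (G : A * B -> \bar R) : measurable_fun setT G ->
  (forall z, 0 <= G z)%E ->
  (\int[J]_z G z = \int[m]_a \int[post a]_b G (a, b))%E.
Proof.
move=> mG G0; have [mP postP] := mpostP.
have mG2 a : measurable_fun setT (fun b => G (a, b)).
  exact: measurableT_comp mG (measurable_pair1 a).
have mw2 a : measurable_fun setT (fun b => (w a b)%:E).
  exact: measurableT_comp mwE (measurable_pair1 a).
rewrite (ge0_integral_density JP)//.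
rewrite fubini_tonelli1//; last 2 first.
- exact: emeasurable_funM.
- by move=> z; rewrite mule_ge0// lee_fin ltW.
rewrite (ge0_integral_density mP)//; last 2 first.
- exact: measurable_kernel_integral.
- by move=> a; exact: integral_ge0.
apply: eq_integral => a _.
rewrite (ge0_integral_density (postP a))//.
have Z0 := evidence_gt0 a.
rewrite -ge0_integralZr//; last 3 first.
- apply: emeasurable_funM => //; apply/measurable_EFinP.
  by apply: measurable_funM => //; exact/measurable_EFinP/mw2.
- by move=> b _; rewrite mule_ge0// lee_fin divr_ge0 ?ltW.
- by rewrite lee_fin ltW.
by apply: eq_integral => b _; rewrite -muleA -EFinM divfK// gt_eqF.
Qed.

Lemma observation_joint (G : A * B -> \bar R) : measurable_fun setT G ->
  (forall z, 0 <= G z)%E ->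
  (\int[J]_z G z = \int[mu]_b \int[k b]_a G (a, b))%E.
Proof.
move=> mG G0.
rewrite (ge0_integral_density JP)//.
rewrite -/(product_measure1 ga mu).
rewrite fubini_tonelli1 ?fubini_tonelli//; last 4 first.
- exact: emeasurable_funM.
- by move=> z; rewrite mule_ge0// lee_fin ltW.
- exact: emeasurable_funM.
- by move=> z; rewrite mule_ge0// lee_fin ltW.
apply: eq_integral => b _.
rewrite (ge0_integral_density (kP b))//.
exact: measurableT_comp mG (measurable_pair2 b).
Qed.

(** Both disintegrations of [J] are applied to the event that the signal lies in [S]; on the
    observation side the kernel has mass one, which leaves mu S. *)
Lemma posterior_mixture S : measurable S -> mu S = (\int[m]_a post a S)%E.
Proof.
move=> mS.
pose G (z : A * B) : \bar R := (\1_S z.2)%:E.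
have mG : measurable_fun setT G.
  by apply/measurable_EFinP; apply: measurableT_comp => //; exact: measurable_indic.
have G0 z : (0 <= G z)%E by rewrite lee_fin.
have := posterior_joint mG G0; rewrite observation_joint// /G /=.
under eq_integral => b _ do
  rewrite integral_cst// [X in (_ * X)%E](prob_kernel (s := k)) mule1.
rewrite integral_indic// setIT => ->.
by apply: eq_integral => a _; rewrite integral_indic// setIT.
Qed.

Lemma integrates_posterior (G : A * B -> R) c : integrates J G c ->
  integrates m (fun a => \int[post a]_b G (a, b)) c.
Proof.
move=> Gc; apply: (@integrates_disintegration _ _ _ _ _ _ _ m post J id) => //.
exact: posterior_joint.
Qed.

Lemma ae_integrable_posterior (G : A * B -> R) c : integrates J G c ->
  {ae m, forall a, (post a).-integrable setT (fun b => (G (a, b))%:E)}.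
Proof.
move=> Gc; apply: (@ae_integrable_disintegration _ _ _ _ _ _ _ m post J id _ _ _ _ Gc) => //.
exact: posterior_joint.
Qed.

Lemma integrates_observation (G : A * B -> R) c : integrates J G c ->
  integrates mu (fun b => \int[k b]_a G (a, b)) c.
Proof.
move=> Gc; apply: (@integrates_disintegration _ _ _ _ _ _ _ mu k J
  (fun z => (z.2, z.1)) _ _ _ _ Gc) => //.
  exact: measurable_swap.
exact: observation_joint.
Qed.

Lemma integrates_signal (g : B -> R) c : integrates mu g c ->
  integrates J (fun z => g z.2) c.
Proof.
suff H (h : B -> \bar R) : measurable_fun setT h -> (forall b, 0 <= h b)%E ->
    (\int[J]_z h z.2 = \int[mu]_b h b)%E.
  move=> gc; have [/integrableP[mg goo] gE] := gc; split.
    apply/integrableP; split; first exact: (measurableT_comp mg measurable_snd).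
    by rewrite (H (fun b => `|(g b)%:E|)%E)//; exact: measurableT_comp.
  rewrite -gE integralE [RHS]integralE.
  congr (_ - _)%E.
    rewrite -H//; last exact: measurable_funepos.
    by apply: eq_integral => z _; rewrite !funeposE.
  rewrite -H//; last exact: measurable_funeneg.
  by apply: eq_integral => z _; rewrite !funenegE.
move=> mh h0; rewrite (observation_joint (G := fun z => h z.2))//; last first.
  exact: measurableT_comp mh measurable_snd.
apply: eq_integral => b _ /=.
by rewrite integral_cst// [X in (_ * X)%E](prob_kernel (s := k)) mule1.
Qed.

End joint.
End channel.

(** * The Gaussian channel *)

Section gaussian.
Context (R : realType) (n : nat).

(** The random vector lives on an arbitrary probability space, so that a sum of independent vectors
    is a vector on the product space, where Laplace transforms multiply. *)
Definition has_mgf d (T : measurableType d) (ga : probability T R)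
    (th : T -> 'I_n -> R) (q : ('I_n -> R) -> R) :=
  (forall i, measurable_fun setT (th ^~ i)) /\
  forall u, (\int[ga]_p (expR (\sum_i th p i * u i))%:E = (expR (q u))%:E)%E.

Definition gaussian (t : R) d (T : measurableType d) (ga : probability T R) th :=
  has_mgf ga th (fun u => t / 2 * \sum_i u i ^+ 2).

Lemma has_mgf_prod d1 d2 (T1 : measurableType d1) (T2 : measurableType d2)
    (ga : probability T1 R) (et : probability T2 R) th xi q1 q2 :
  has_mgf ga th q1 -> has_mgf et xi q2 ->
  has_mgf (ga \x et)%E (fun p i => th p.1 i + xi p.2 i) (fun u => q1 u + q2 u).
Proof.
move=> [mth thq] [mxi xiq]; split=> [i|u].
  apply: measurable_funD.
    exact: measurableT_comp (mth i) measurable_fst.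
  exact: measurableT_comp (mxi i) measurable_snd.
rewrite fubini_tonelli1//=; last first.
  apply/measurable_EFinP; apply: measurableT_comp => //; apply: measurable_sum => i.
  apply: measurable_funM => //; apply: measurable_funD.
    exact: measurableT_comp (mth i) measurable_fst.
  exact: measurableT_comp (mxi i) measurable_snd.
transitivity (\int[ga]_p ((expR (\sum_i th p i * u i))%:E * (expR (q2 u))%:E))%E.
  apply: eq_integral => p _; rewrite -xiq -ge0_integralZl//.
  - apply: eq_integral => r _; rewrite -EFinM -expRD -big_split/=.
    by under eq_bigr do rewrite mulrDl.
  - apply/measurable_EFinP; apply: measurableT_comp => //; apply: measurable_sum => i.
    exact: measurable_funM.
rewrite ge0_integralZr//.
- by rewrite thq -EFinM expRD.
- apply/measurable_EFinP; apply: measurableT_comp => //; apply: measurable_sum => i.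
  exact: measurable_funM.
Qed.

Lemma gaussian_prod t h d1 d2 (T1 : measurableType d1) (T2 : measurableType d2)
    (ga : probability T1 R) (et : probability T2 R) th xi :
  gaussian t ga th -> gaussian h et xi ->
  gaussian (t + h) (ga \x et)%E (fun p i => th p.1 i + xi p.2 i).
Proof.
move=> thP xiP; have [mf E] := has_mgf_prod thP xiP; split => // u.
by rewrite E -mulrDl -mulrDl.
Qed.

(** Completing the square: exp(x u) times the density of N(0, s^2) is exp(s^2 u^2 / 2) times the
    density of N(s^2 u, s^2). *)
Lemma normal_mgf (s u : R) : s != 0 ->
  (\int[normal_prob 0 s]_x (expR (x * u))%:E = (expR (s ^+ 2 / 2 * u ^+ 2))%:E)%E.
Proof.
move=> s0; have nP : is_density lebesgue_measure (normal_prob 0 s) (normal_pdf 0 s).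
  by split => //; [exact: measurable_normal_pdf|exact: normal_pdf_ge0].
rewrite (ge0_integral_density nP)//; last first.
  apply/measurable_EFinP; apply: measurableT_comp => //; exact: measurable_funM.
transitivity (\int[lebesgue_measure]_x
    ((expR (s ^+ 2 / 2 * u ^+ 2))%:E * (normal_pdf (s ^+ 2 * u) s x)%:E))%E.
  apply: eq_integral => x _; rewrite -!EFinM; congr (_%:E).
  rewrite !normal_pdfE// /normal_fun mulrCA [RHS]mulrCA -!expRD.
  by congr (_ * expR _); field.
rewrite ge0_integralZl//; last 2 first.
- by apply/measurable_EFinP; exact: measurable_normal_pdf.
- by move=> x _; rewrite lee_fin normal_pdf_ge0.
by rewrite integral_normal_pdf mule1.
Qed.

Lemma gaussian_exists t : 0 < t ->
  exists d (T : measurableType d) (ga : probability T R) th, gaussian t ga th.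
Proof.
move=> t0; pose s := Num.sqrt t.
have s0 : s != 0 by rewrite gt_eqF// sqrtr_gt0.
(* Induction on a list of coordinates, each adjoining an independent scalar normal variable on a new
   factor of the space. *)
suff H (r : seq 'I_n) : exists d (T : measurableType d) (ga : probability T R) th,
    has_mgf ga th (fun u => \sum_(i <- r) t / 2 * u i ^+ 2).
  have [d [T [ga [th [mth thE]]]]] := H (index_enum 'I_n).
  by exists d, T, ga, th; split => // u; rewrite thE mulr_sumr.
elim: r => [|i r [d [T [ga [th thP]]]]].
  (* The zero vector may live on any probability space; this one is at hand. *)
  exists _, (measurableTypeR R), (normal_prob 0 s), (fun _ _ => 0); split => [//|u].
  under eq_integral do under eq_bigr do rewrite mul0r.
  under eq_integral do rewrite big1_eq.
  by rewrite big_nil integral_cst//= [X in (_ * X)%E]probability_setT mule1.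
have iP : has_mgf (normal_prob 0 s)
    (fun x j => if j == i then x else 0) (fun u => t / 2 * u i ^+ 2).
  split => [j|u]; first by case: (j == i).
  rewrite -(sqr_sqrtr (ltW t0)) -normal_mgf//.
  apply: eq_integral => x _; rewrite (bigD1 i)//= eqxx big1 ?addr0// => j /negPf ->.
  by rewrite mul0r.
have [mf E] := has_mgf_prod iP thP.
exists _, _, (normal_prob 0 s \x ga)%E,
  (fun p j => (if j == i then p.1 else 0) + th p.2 j).
by split => // u; rewrite big_cons; exact: E.
Qed.

End gaussian.

Section gaussian_channel.
Context (R : realType) (n : nat) (mu : probability (n.-tuple R) R).
Context d (T : measurableType d) (ga : probability T R) (th : T -> 'I_n -> R) (t : R).
Hypotheses (t0 : 0 < t) (gaP : gaussian t ga th).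

(* The density, with respect to ga, of t x + (centered Gaussian of variance t)
   when the signal is x. *)
Definition gaussian_weight (p : T) (x : n.-tuple R) :=
  expR (\sum_i th p i * tnth x i - t / 2 * \sum_i tnth x i ^+ 2).

Local Notation w := gaussian_weight.

Let mth i : measurable_fun setT (th ^~ i). Proof. by case: gaP. Qed.

Lemma measurable_gaussian_exponent : measurable_fun setT (fun z : T * n.-tuple R =>
  \sum_i th z.1 i * tnth z.2 i - t / 2 * \sum_i tnth z.2 i ^+ 2).
Proof.
have mx i : measurable_fun setT (fun z : T * n.-tuple R => tnth z.2 i).
  exact: measurableT_comp (@measurable_tnth _ _ _ i) measurable_snd.
apply: measurable_funB.
  apply: measurable_sum => i; apply: measurable_funM => //.
  exact: measurableT_comp (mth i) measurable_fst.
apply: measurable_funM => //; apply: measurable_sum => i.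
exact: measurable_funX.
Qed.

(** Completing the square: the exponent is largest where t x = [th p]. The bound does not depend on
    x, so each posterior density with respect to mu is bounded. *)
Lemma gaussian_weight_le p x : w p x <= expR (\sum_i th p i ^+ 2 / (2 * t)).
Proof.
rewrite ler_expR mulr_sumr -sumrB; apply: ler_sum => i _.
have : 0 <= (th p i - t * tnth x i) ^+ 2 / (2 * t).
  by rewrite divr_ge0 ?sqr_ge0// mulr_ge0// ltW.
rewrite (_ : _ / _ = th p i ^+ 2 / (2 * t) - th p i * tnth x i
  + t / 2 * tnth x i ^+ 2); last by field; rewrite gt_eqF.
lra.
Qed.

Lemma gaussian_is_channel : channel ga mu w.
Proof.
have mw : measurable_fun setT (fun z => w z.1 z.2).
  exact: measurableT_comp measurable_gaussian_exponent.
split => //.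
- by move=> p x; exact: expR_gt0.
- move=> p; have hc := finite_measure_integrable_cst mu
    (expR (\sum_i th p i ^+ 2 / (2 * t))) measurableT.
  apply: (le_integrable measurableT _ _ hc).
  + apply/measurable_EFinP.
    exact: (measurableT_comp mw (measurable_pair1 p)).
  + by move=> x _; rewrite /= lee_fin !ger0_norm ?expR_ge0// gaussian_weight_le.
- move=> x; rewrite /w; under eq_integral do rewrite expRD EFinM.
  rewrite ge0_integralZr//; last first.
    apply/measurable_EFinP; apply: measurableT_comp => //; apply: measurable_sum => i.
    exact: measurable_funM.
  (* The Laplace transform of [th] at x is the inverse of the factor exp(-t |x|^2 / 2). *)
  by rewrite gaP.2 -EFinM -expRD subrr expR0.
Qed.

Variables (k : R.-pker (n.-tuple R) ~> T).
Hypothesis kP : forall x, is_density ga (k x) (w ^~ x).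

Definition noise (u : 'I_n -> R) x p := \sum_i u i * (th p i - t * tnth x i).

Lemma measurable_noise u x : measurable_fun setT (noise u x).
Proof.
by apply: measurable_sum => i; apply: measurable_funM => //; exact: measurable_funB.
Qed.

(** Under [k x] the law of [th] is tilted by its weight, so the integral reduces to the Laplace
    transform under [ga] at x + s u. Expanding the square shows that the tilt merely translates [th]
    by t x (Cameron-Martin). *)
Lemma noise_mgf u x s : (\int[k x]_p (expR (s * noise u x p))%:E =
  (expR (s ^+ 2 * (t * \sum_i u i ^+ 2) / 2))%:E)%E.
Proof.
rewrite (ge0_integral_density (kP x))//; last first.
  apply/measurable_EFinP; apply: measurableT_comp => //.
  by apply: measurable_funM => //; exact: measurable_noise.
pose c := - (t / 2 * \sum_i tnth x i ^+ 2) - s * t * \sum_i u i * tnth x i.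
transitivity (\int[ga]_p ((expR (\sum_i th p i * (tnth x i + s * u i)))%:E * (expR c)%:E))%E.
  apply: eq_integral => p _; rewrite -!EFinM /w -!expRD; congr (expR _)%:E.
  have -> : \sum_i th p i * (tnth x i + s * u i) =
      s * noise u x p + \sum_i th p i * tnth x i + s * t * \sum_i u i * tnth x i.
    rewrite /noise !mulr_sumr -!big_split/=; apply: eq_bigr => i _; ring.
  rewrite /c; ring.
rewrite ge0_integralZr//; last first.
  apply/measurable_EFinP; apply: measurableT_comp => //; apply: measurable_sum => i.
  exact: measurable_funM.
rewrite gaP.2 -EFinM -expRD; congr (expR _)%:E.
have -> : \sum_i (tnth x i + s * u i) ^+ 2 = \sum_i tnth x i ^+ 2 +
    2 * s * (\sum_i u i * tnth x i) + s ^+ 2 * \sum_i u i ^+ 2.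
  rewrite !mulr_sumr -!big_split/=; apply: eq_bigr => i _; ring.
by rewrite /c; field.
Qed.

Let var_ge0 u : 0 <= t * \sum_(i < n) u i ^+ 2.
Proof. by rewrite mulr_ge0 ?(ltW t0)// sumr_ge0// => i _; exact: sqr_ge0. Qed.

Lemma noise_mean u x : integrates (k x) (noise u x) 0.
Proof.
apply: (mgf_mean (prob_kernel x) (measurable_noise u x) (var_ge0 u)) => s.
exact: noise_mgf.
Qed.

Lemma noise_sqr u x : exists2 c,
  integrates (k x) (fun p => noise u x p ^+ 2) c & c <= t * \sum_i u i ^+ 2.
Proof.
apply: (mgf_sqr_integrates (prob_kernel x) (measurable_noise u x) (var_ge0 u)) => s.
exact: noise_mgf.
Qed.

Lemma noise_sixth u x : exists2 c,
  integrates (k x) (fun p => noise u x p ^+ 6) c &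
  c <= 1440 * expR (t * (\sum_i u i ^+ 2) / 2).
Proof.
exact: (mgf_sixth_integrates (measurable_noise u x) (noise_mgf u x)).
Qed.

End gaussian_channel.

(** * Covariance matrices *)

Section covariance_theory.
Context (R : realType) (n : nat).

(** Vectors are functions, so that a row [C i] of a matrix is itself an admissible argument. *)
Definition qform (C : 'M[R]_n) (u : 'I_n -> R) := \sum_i \sum_j u i * u j * C i j.

(** Bias-variance decomposition of a linear functional about an arbitrary constant; the posterior
    mean square errors below are evaluated with it. *)
Lemma integrates_quadratic (ka : {measure set (n.-tuple R) -> \bar R}) u be :
  ka setT = 1%E -> has_cov ka ->
  integrates ka (fun x => (\sum_i u i * tnth x i - be) ^+ 2)
    (qform (Cov ka) u + (\sum_i u i * mean ka i 0 - be) ^+ 2).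
Proof.
move=> ka1 [m1 m2].
have h2 := integrates_sum (index_enum 'I_n) (P := xpredT) (fun i _ =>
  integrates_sum (index_enum 'I_n) (P := xpredT) (fun j _ =>
    integratesZ (u i * u j) (integratesP (m2 i j)))).
have h1 := integrates_sum (index_enum 'I_n) (P := xpredT) (fun i _ =>
    integratesZ (u i) (integratesP (m1 i))).
have := integratesD (integratesD h2 (integratesZ (- 2 * be) h1)) (integrates_cst (be ^+ 2) ka1).
set c := (X in integrates _ _ X -> _) => H.
rewrite (_ : qform _ _ + _ = c); last first.
  pose A := \sum_i u i * \int[ka]_x tnth x i.
  rewrite /c /qform /Cov /second_moment -/A.
  rewrite (_ : \sum_i u i * mean ka i 0 = A); last first.
    by apply: eq_bigr => i _; rewrite mxE.
  under eq_bigr => i _ do under eq_bigr => j _ do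
    rewrite !mxE big_ord1 !mxE mulrBr.
  under eq_bigr => i _ do rewrite sumrB.
  rewrite sumrB [X in _ - X](_ : _ = A ^+ 2); first by ring.
  rewrite expr2 /A mulr_suml; apply: eq_bigr => i _.
  by rewrite mulr_sumr; apply: eq_bigr => j _; ring.
apply: eq_integrates H => x; set L := \sum_i u i * _.
rewrite [X in X + _ + _](_ : _ = L ^+ 2); first by ring.
rewrite expr2 /L mulr_suml; apply: eq_bigr => i _.
by rewrite mulr_sumr; apply: eq_bigr => j _; ring.
Qed.

Lemma qform_Cov_ge0 (ka : {measure set (n.-tuple R) -> \bar R}) u :
  ka setT = 1%E -> has_cov ka -> 0 <= qform (Cov ka) u.
Proof.
move=> ka1 kac.
have := integrates_quadratic u (\sum_i u i * mean ka i 0) ka1 kac.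
rewrite subrr expr0n/= addr0 => h.
by apply: le_integrates (integrates0 ka) h _ => x; exact: sqr_ge0.
Qed.

Lemma Cov_sym (ka : {measure set (n.-tuple R) -> \bar R}) i j :
  Cov ka i j = Cov ka j i.
Proof.
rewrite !mxE !big_ord1 !mxE [in X in _ - X]mulrC; congr (_ - _).
by congr Rintegral; apply/funext => x; rewrite mulrC.
Qed.

Definition basis (i j : 'I_n) : R := (j == i)%:R.

Lemma sum_basis i (f : 'I_n -> R) : \sum_j basis i j * f j = f i.
Proof.
rewrite (bigD1 i)//= /basis eqxx mul1r big1 ?addr0// => j /negPf ->.
by rewrite mul0r.
Qed.

Lemma sum_basis_sqr i : \sum_j basis i j ^+ 2 = 1.
Proof.
rewrite -[RHS](sum_basis i (fun=> 1)); apply: eq_bigr => j _.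
by rewrite mulr1 /basis; case: eqP => _; rewrite ?expr1n ?expr0n.
Qed.

Lemma qformE C u : qform C u = \sum_i u i * \sum_j u j * C i j.
Proof.
by apply: eq_bigr => i _; rewrite mulr_sumr; apply: eq_bigr => j _; rewrite mulrA.
Qed.

Lemma qform_basis C i : qform C (basis i) = C i i.
Proof. by rewrite qformE sum_basis sum_basis. Qed.

Lemma mxtrace_sqr (C : 'M[R]_n) : (forall i j, C i j = C j i) ->
  \tr (C *m C) = \sum_i \sum_j C i j ^+ 2.
Proof.
move=> Cs; apply: eq_bigr => i _; rewrite mxE; apply: eq_bigr => j _.
by rewrite (Cs j i) expr2.
Qed.

Section psd_entries.
Variable C : 'M[R]_n.
Hypotheses (Cs : forall i j, C i j = C j i) (C0 : forall u, 0 <= qform C u).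

Lemma psd_diag_ge0 i : 0 <= C i i.
Proof. by rewrite -qform_basis. Qed.

Lemma psd_trace_ge0 : 0 <= \tr C.
Proof. by apply: sumr_ge0 => i _; exact: psd_diag_ge0. Qed.

Lemma psd_diag_le i : C i i <= \tr C.
Proof.
rewrite /mxtrace (bigD1 i)//= lerDl; apply: sumr_ge0 => j _.
exact: psd_diag_ge0.
Qed.

(** Nonnegativity of the form at e_i + e_j and e_i - e_j gives 2 |C i j| <= C i i + C j j. *)
Lemma psd_entry_le i j : `|C i j| <= \tr C.
Proof.
have q (s : R) : qform C (fun l => basis i l + s * basis j l) =
    C i i + 2 * s * C i j + s ^+ 2 * C j j.
  rewrite qformE.
  have S (f : 'I_n -> R) : \sum_l (basis i l + s * basis j l) * f l = f i + s * f j.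
    under eq_bigr do rewrite mulrDl -mulrA.
    by rewrite big_split/= sum_basis -mulr_sumr sum_basis.
  by rewrite S !S (Cs j i); ring.
have := C0 (fun l => basis i l + 1 * basis j l).
have := C0 (fun l => basis i l + (-1) * basis j l).
rewrite !q => h1 h2; have := psd_diag_le i; have := psd_diag_le j.
by rewrite ler_norml => *; apply/andP; split; lra.
Qed.

Lemma psd_entry_sqr_le i j : C i j ^+ 2 <= \tr C ^+ 2.
Proof. by rewrite -real_normK ?num_real// lerXn2r ?nnegrE ?psd_trace_ge0// psd_entry_le. Qed.

Lemma psd_trace_sqr_le : \tr (C *m C) <= n%:R ^+ 2 * \tr C ^+ 2.
Proof.
rewrite mxtrace_sqr//.
apply: (@le_trans _ _ (\sum_(i < n) \sum_(j < n) \tr C ^+ 2)).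
  by apply: ler_sum => i _; apply: ler_sum => j _; exact: psd_entry_sqr_le.
by rewrite !sumr_const !card_ord -mulrnA -[leLHS]mulr_natl natrM -expr2.
Qed.

Lemma psd_trace_sqr_ge0 : 0 <= \tr (C *m C).
Proof. by rewrite mxtrace_sqr//; apply: sumr_ge0 => i _; apply: sumr_ge0 => j _; exact: sqr_ge0. Qed.

(* Tr ((Id - h C) C (Id - h C)) *)
Lemma psd_shrink_le h : 0 <= h ->
  \sum_i qform C (fun j => basis i j - h * C i j) <=
  \tr C - 2 * h * \tr (C *m C) + h ^+ 2 * (n%:R ^+ 3 * \tr C ^+ 3).
Proof.
move=> h0.
have q i : qform C (fun j => basis i j - h * C i j) =
    C i i - 2 * h * (\sum_j C i j ^+ 2) + h ^+ 2 * qform C (C i).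
  have S (f : 'I_n -> R) : \sum_l (basis i l - h * C i l) * f l = f i - h * \sum_l C i l * f l.
    under eq_bigr do rewrite mulrBl -mulrA.
    by rewrite sumrB sum_basis -mulr_sumr.
  rewrite qformE S !S.
  under [X in _ - h * X]eq_bigr do rewrite S.
  rewrite [in X in h ^+ 2 * X]qformE.
  rewrite (_ : \sum_j C i j ^+ 2 = \sum_l C i l * C i l); last by apply: eq_bigr.
  under [X in _ - h * X]eq_bigr => l _ do rewrite mulrBr (Cs l i) [C i l * (h * _)]mulrCA.
  rewrite sumrB -mulr_sumr; ring.
under eq_bigr do rewrite q.
rewrite big_split/= sumrB -!mulr_sumr -mxtrace_sqr// lerD2l ler_wpM2l ?sqr_ge0//.
have tr0 := psd_trace_ge0.
(* The h^2 term is Tr(C^3), a sum of n^3 products of three entries, each at most Tr C in absolute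
   value. *)
apply: (@le_trans _ _ (\sum_(i < n) \sum_(j < n) \sum_(l < n) \tr C ^+ 3)).
  apply: ler_sum => i _; apply: ler_sum => j _; apply: ler_sum => l _.
  apply: le_trans (ler_norm _) _; rewrite !normrM exprS expr2 mulrA.
  by rewrite !ler_pM ?mulr_ge0// psd_entry_le.
rewrite !sumr_const !card_ord -!mulrnA -[leLHS]mulr_natl !natrM.
by rewrite (_ : n%:R * (n%:R * n%:R) = n%:R ^+ 3 :> R)//; ring.
Qed.

End psd_entries.

End covariance_theory.

(** Convexity of the cube through its tangent at the average s: y^3 - 3 s^2 y + 2 s^3 = (y - s)^2 (y
    + 2 s). *)
Lemma sum_cube_le (R : realType) (n : nat) (y : 'I_n -> R) :
  (forall i, 0 <= y i) -> (\sum_i y i) ^+ 3 <= n%:R ^+ 2 * \sum_i y i ^+ 3.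
Proof.
move=> y0; have S0 : 0 <= \sum_i y i by apply: sumr_ge0.
case: n y y0 S0 => [|n] y y0 S0; first by rewrite !big_ord0 expr0n/= mulr0.
have N0 : 0 < n.+1%:R :> R by rewrite ltr0n.
set S := \sum_i y i in S0 *; set s := S / n.+1%:R.
have s0 : 0 <= s by rewrite divr_ge0// ltW.
have SE : S = s * n.+1%:R by rewrite /s divfK// gt_eqF.
have : \sum_i (3 * s ^+ 2 * y i - 2 * s ^+ 3) <= \sum_i y i ^+ 3.
  apply: ler_sum => i _; rewrite -subr_ge0.
  rewrite (_ : _ - _ = (y i - s) ^+ 2 * (y i + 2 * s)); last by ring.
  by rewrite mulr_ge0 ?sqr_ge0// addr_ge0// mulr_ge0.
rewrite sumrB -mulr_sumr -/S sumr_const card_ord -[_ *+ n.+1]mulr_natr => h.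
have := ler_wpM2l (sqr_ge0 n.+1%:R) h; apply: le_trans.
by rewrite SE; lra.
Qed.

(** * Moments of the posterior covariance *)

Section gaussian_posterior.
Context (R : realType) (n : nat) (mu : probability (n.-tuple R) R).
Context d (T : measurableType d) (ga : probability T R) (th : T -> 'I_n -> R) (t : R).
Hypotheses (muC : has_cov mu) (t0 : 0 < t) (gaP : gaussian t ga th).

Local Notation w := (gaussian_weight th t).

Let wP : channel ga mu w := gaussian_is_channel mu t0 gaP.

Variables (m : probability T R) (post : R.-pker T ~> (n.-tuple R)).
Hypothesis pP : is_posterior ga mu w m post.

Let mth i : measurable_fun setT (th ^~ i). Proof. by case: gaP. Qed.
Let Z0 := evidence_gt0 wP.

Lemma integrable_posterior f p : measurable_fun setT f ->
  mu.-integrable setT (EFin \o f) -> (post p).-integrable setT (EFin \o f).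
Proof.
move=> mf fi; have [_ dP] := pP; apply/(integrable_density (dP p) mf).
set K := expR (\sum_i th p i ^+ 2 / (2 * t)) / evidence mu w p.
apply: (le_integrable measurableT _ _ (integrableZl measurableT K fi)).
  by apply/measurable_EFinP; apply: measurable_funM => //; have [] := dP p.
move=> x _; rewrite /= lee_fin [leRHS]normrM [leLHS]normrM mulrC ler_wpM2r//.
have p0 : 0 <= w p x / evidence mu w p.
  by rewrite divr_ge0 ?ltW// expR_gt0.
rewrite (ger0_norm p0) (le_trans _ (ler_norm _))//.
by rewrite ler_wpM2r ?gaussian_weight_le// invr_ge0 ltW.
Qed.

Let mx i : measurable_fun setT (fun x : n.-tuple R => tnth x i).
Proof. exact: measurable_tnth. Qed.

Lemma posterior_has_cov p : has_cov (post p).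
Proof.
case: muC => m1 m2; split=> [i|i j].
  exact: (integrable_posterior p (mx i) (m1 i)).
exact: (integrable_posterior p (measurable_funM (mx i) (mx j)) (m2 i j)).
Qed.

Let post1 p : post p setT = 1%E := prob_kernel p.

Let Cs p i j : Cov (post p) i j = Cov (post p) j i := Cov_sym (post p) i j.

Let C0 p u : 0 <= qform (Cov (post p)) u.
Proof. exact: qform_Cov_ge0 (post1 p) (posterior_has_cov p). Qed.

Lemma measurable_mean i : measurable_fun setT (fun p => mean (post p) i 0).
Proof.
rewrite (_ : (fun _ => _) = fun p => \int[post p]_x tnth x i); last first.
  by apply/funext => p; rewrite mxE.
apply: (@measurable_kernel_Rintegral _ _ _ _ _ post (fun z => tnth z.2 i)).
exact: measurableT_comp (mx i) measurable_snd.
Qed.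

Lemma CovE (ka : {measure set (n.-tuple R) -> \bar R}) i j :
  Cov ka i j = \int[ka]_x (tnth x i * tnth x j) - mean ka i 0 * mean ka j 0.
Proof. by rewrite [LHS]mxE !mxE big_ord1 !mxE. Qed.

Lemma measurable_Cov i j : measurable_fun setT (fun p => Cov (post p) i j).
Proof.
under eq_fun do rewrite CovE.
apply: measurable_funB; last by apply: measurable_funM; exact: measurable_mean.
apply: (@measurable_kernel_Rintegral _ _ _ _ _ post (fun z => tnth z.2 i * tnth z.2 j)).
by apply: measurable_funM;
  [exact: measurableT_comp (mx i) measurable_snd|exact: measurableT_comp (mx j) measurable_snd].
Qed.

Lemma measurable_tr_Cov : measurable_fun setT (fun p => \tr (Cov (post p))).
Proof. by apply: measurable_sum => i; exact: measurable_Cov. Qed.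

Lemma measurable_tr_Cov_sqr :
  measurable_fun setT (fun p => \tr (Cov (post p) *m Cov (post p))).
Proof.
under eq_fun do rewrite mxtrace_sqr//.
apply: measurable_sum => i; apply: measurable_sum => j.
by apply: measurable_funX; exact: measurable_Cov.
Qed.

(** Trades the average over the posterior for an average over the noise at a fixed signal, where
    Gaussian moments are available. [G] will be a power of the error of an explicit estimator. *)
Lemma posterior_observation_le (k : R.-pker (n.-tuple R) ~> T) (q : T -> R)
    (G : T * n.-tuple R -> R) :
  (forall x, is_density ga (k x) (w ^~ x)) ->
  measurable_fun setT q -> (forall p, 0 <= q p) ->
  measurable_fun setT G -> (forall z, 0 <= G z) ->
  (forall p, (q p)%:E <= \int[post p]_x (G (p, x))%:E)%E ->
  (\int[m]_p (q p)%:E <= \int[mu]_x \int[k x]_p (G (p, x))%:E)%E.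
Proof.
move=> kP mq q0 mG G0 qG; have [J JP] := joint_exists wP.
have mGE : measurable_fun setT (EFin \o G) by exact/measurable_EFinP.
have GE0 z : (0 <= (EFin \o G) z)%E by rewrite lee_fin.
rewrite -(observation_joint wP kP JP mGE)// (posterior_joint wP pP JP mGE)//.
apply: ge0_le_integral => //.
- by move=> p _; rewrite lee_fin.
- exact/measurable_EFinP.
- exact: measurable_kernel_integral mGE.
Qed.

Lemma posterior_le (k : R.-pker (n.-tuple R) ~> T) (q : T -> R) (G : T * n.-tuple R -> R) h c :
  (forall x, is_density ga (k x) (w ^~ x)) ->
  measurable_fun setT q -> (forall p, 0 <= q p) ->
  measurable_fun setT G -> (forall z, 0 <= G z) ->
  (forall p, (q p)%:E <= \int[post p]_x (G (p, x))%:E)%E ->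
  (forall x, \int[k x]_p (G (p, x))%:E <= (h x)%:E)%E ->
  integrates mu h c -> exists2 c', integrates m q c' & 0 <= c' <= c.
Proof.
move=> kP mq q0 mG G0 qG Gh hc.
have mGE : measurable_fun setT (EFin \o G) by exact/measurable_EFinP.
apply: integrates_ge0_le => //.
apply: le_trans (posterior_observation_le kP mq q0 mG G0 qG) _.
rewrite -hc.2; apply: ge0_le_integral => //.
- by move=> x _; apply: integral_ge0 => p _; rewrite lee_fin.
- apply: (@measurable_kernel_integral _ _ _ _ _ k (fun z => (G (z.2, z.1))%:E)).
  exact: measurableT_comp mGE (@measurable_swap _ _ _ _).
- by apply/measurable_EFinP; exact: integrates_measurable hc.
Qed.

Lemma integrates_Cov i j : exists c, integrates m (fun p => Cov (post p) i j) c.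
Proof.
have [J JP] := joint_exists wP; have [k kP] := observation_exists wP.
have M i' j' := integrates_posterior wP pP JP
  (integrates_signal wP kP JP (integratesP (muC.2 i' j'))).
have D := integratesD (M i i) (M j j).
have mm := measurable_mean.
suff A : integrates m (fun p => mean (post p) i 0 * mean (post p) j 0)
    (\int[m]_p (mean (post p) i 0 * mean (post p) j 0)).
  have := integratesB (M i j) A => H; eexists; apply: eq_integrates H => p.
  by rewrite CovE.
(* A product of posterior means is controlled by their squares, and these by the posterior second
   moments because variances are nonnegative. *)
apply: (dominated_integrates _ _ D); first exact: measurable_funM.
move=> p; have := C0 p (basis R i); have := C0 p (basis R j).
rewrite !qform_basis !CovE /= => h1 h2.
set a := mean _ _ _ in h2 *; set b := mean _ _ _ in h1 *.
have := sqr_ge0 (a + b); have := sqr_ge0 (a - b) => h3 h4.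
by rewrite /= ler_norml; apply/andP; split; lra.
Qed.

Lemma integrates_tr_Cov : exists c, integrates m (fun p => \tr (Cov (post p))) c.
Proof.
have /choice[c cP] i := integrates_Cov i i.
by exists (\sum_i c i); apply: integrates_sum => i _; exact: cP.
Qed.

Lemma le_post_integral p (g G : n.-tuple R -> R) c : measurable_fun setT G ->
  (forall x, 0 <= G x) -> integrates (post p) g c -> (forall x, g x <= G x) ->
  (c%:E <= \int[post p]_x (G x)%:E)%E.
Proof.
move=> mG G0 gc gG.
have [->|Goo] := eqVneq (\int[post p]_x (G x)%:E)%E +oo%E; first by rewrite leey.
have Gi : integrates (post p) G (\int[post p]_x G x).
  by apply: ge0_integrates => //; rewrite ltey.
by rewrite Gi.2 lee_fin; exact: le_integrates gc Gi gG.
Qed.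

Lemma measurable_noise2 u : measurable_fun setT (fun z => noise th t u z.2 z.1).
Proof.
apply: measurable_sum => i; apply: measurable_funM => //; apply: measurable_funB.
  exact: measurableT_comp (mth i) measurable_fst.
by apply: measurable_funM => //; exact: measurableT_comp (mx i) measurable_snd.
Qed.

Lemma noise_affine_sqr (k : R.-pker (n.-tuple R) ~> T) u x (al : R) :
  (forall x, is_density ga (k x) (w ^~ x)) ->
  exists2 c, integrates (k x) (fun p => (al - noise th t u x p) ^+ 2) c &
    c <= al ^+ 2 + t * \sum_i u i ^+ 2.
Proof.
move=> kP; have [c cP cle] := noise_sqr t0 gaP kP u x.
have H := integratesD (integratesD (integrates_cst (al ^+ 2) (prob_kernel x))
  (integratesZ (- 2 * al) (noise_mean t0 gaP kP u x))) cP.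
exists (al ^+ 2 + - 2 * al * 0 + c); last by rewrite mulr0 addr0 lerD2l.
by apply: eq_integrates H => p; ring.
Qed.

Lemma noise_basis i x p : noise th t (basis R i) x p = th p i - t * tnth x i.
Proof. exact: sum_basis. Qed.

Lemma posterior_Cov_le u : exists2 c,
  integrates m (fun p => qform (Cov (post p)) u) c & c <= t^-1 * \sum_i u i ^+ 2.
Proof.
have [k kP] := observation_exists wP.
have mq : measurable_fun setT (fun p => qform (Cov (post p)) u).
  apply: measurable_sum => i; apply: measurable_sum => j.
  by apply: measurable_funM => //; exact: measurable_Cov.
have mN := measurable_noise2 u.
have [] := @posterior_le k (fun p => qform (Cov (post p)) u)
  (* The squared error of [th] / t as an estimator of the signal, in the direction u. *)
  (fun z => t ^- 2 * noise th t u z.2 z.1 ^+ 2)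
  (fun=> t^-1 * \sum_i u i ^+ 2) (t^-1 * \sum_i u i ^+ 2) kP mq (C0 ^~ u).
- by apply: measurable_funM => //; exact: measurable_funX.
- by move=> z; rewrite mulr_ge0 ?sqr_ge0// invr_ge0 sqr_ge0.
- move=> p; have Q := integrates_quadratic u (t^-1 * \sum_i u i * th p i) (post1 p) (posterior_has_cov p).
  apply: (@le_trans _ _ (qform (Cov (post p)) u + (\sum_i u i * mean (post p) i 0 - t^-1 * \sum_i u i * th p i)^+2)%:E).
    by rewrite lee_fin lerDl sqr_ge0.
  rewrite -Q.2 le_eqVlt; apply/orP; left; apply/eqP; apply: eq_integral => x _; congr _%:E.
  rewrite -exprVn -exprMn -sqrrN; congr (_ ^+ 2); rewrite opprB.
  rewrite /noise mulr_sumr [in RHS]mulr_sumr -sumrB; apply: eq_bigr => i _.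
  by field; rewrite gt_eqF.
- move=> x; have [c' cP cle] := noise_sqr t0 gaP kP u x.
  rewrite (integratesZ (t ^- 2) cP).2 lee_fin.
  rewrite (_ : t^-1 * _ = t ^- 2 * (t * \sum_i u i ^+ 2)); last by field; rewrite gt_eqF.
  by rewrite ler_wpM2l// invr_ge0 sqr_ge0.
- by apply: integrates_cst; exact: probability_setT.
by move=> c cP /andP[_ c1]; exists c.
Qed.

Let tr0 p : 0 <= \tr (Cov (post p)).
Proof. exact: psd_trace_ge0. Qed.

Lemma integrates_posterior_dist p (b : 'I_n -> R) : exists2 c,
  integrates (post p) (fun x => \sum_i (tnth x i - b i) ^+ 2) c &
  \tr (Cov (post p)) <= c.
Proof.
have H := integrates_sum (index_enum 'I_n) (P := xpredT) (fun i _ =>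
  integrates_quadratic (basis R i) (b i) (post1 p) (posterior_has_cov p)).
eexists; first by apply: eq_integrates H => x; apply: eq_bigr => i _; rewrite sum_basis.
by apply: ler_sum => i _; rewrite qform_basis lerDl sqr_ge0.
Qed.

(** Mean square error of the linear estimator a + s (th - t a), where a is the mean of mu: the
    deviation of the signal shrinks by 1 - s t, and the noise adds s^2 t per coordinate. The gain s
    is left free to be optimised later. *)
Lemma posterior_tr_Cov_le s c : integrates m (fun p => \tr (Cov (post p))) c ->
  c <= (1 - s * t) ^+ 2 * \tr (Cov mu) + n%:R * (s ^+ 2 * t).
Proof.
move=> cP; have [k kP] := observation_exists wP.
pose a i := mean mu i 0.
pose G (z : T * n.-tuple R) :=
  \sum_i (tnth z.2 i - (a i + s * (th z.1 i - t * a i))) ^+ 2.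
have GE x p : G (p, x) = \sum_i ((1 - s * t) * (tnth x i - a i) -
    noise th t (fun j => s * basis R i j) x p) ^+ 2.
  apply: eq_bigr => i _ /=; congr (_ ^+ 2).
  rewrite (_ : noise _ _ _ _ _ = s * noise th t (basis R i) x p); last first.
    by rewrite [RHS]mulr_sumr; apply: eq_bigr => j _; rewrite mulrA.
  by rewrite noise_basis; ring.
have hP := integrates_sum (index_enum 'I_n) (P := xpredT) (fun i _ =>
  integratesD (integratesZ ((1 - s * t) ^+ 2) (integrates_quadratic (basis R i) (a i)
    (probability_setT mu) muC)) (integrates_cst (s ^+ 2 * t) (probability_setT mu))).
have mG : measurable_fun setT G.
  apply: measurable_sum => i; apply: measurable_funX; apply: measurable_funB.
    exact: measurableT_comp (mx i) measurable_snd.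
  apply: measurable_funD => //; apply: measurable_funM => //; apply: measurable_funB => //.
  exact: measurableT_comp (mth i) measurable_fst.
have [] := @posterior_le k (fun p => \tr (Cov (post p))) G _ _ kP measurable_tr_Cov tr0 mG _ _ _ hP.
- by move=> z; apply: sumr_ge0 => i _; exact: sqr_ge0.
- move=> p; have [c' cP' cle] := integrates_posterior_dist p
    (fun i => a i + s * (th p i - t * a i)).
  by rewrite cP'.2 lee_fin.
- move=> x; under eq_integral do rewrite GE.
  have /choice[c' c'P] i : exists c', integrates (k x) (fun p =>
      ((1 - s * t) * (tnth x i - a i) - noise th t (fun j => s * basis R i j) x p) ^+ 2) c' /\
      c' <= (1 - s * t) ^+ 2 * (tnth x i - a i) ^+ 2 + s ^+ 2 * t.
    have [c' h1 h2] := noise_affine_sqr (fun j => s * basis R i j) x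
      ((1 - s * t) * (tnth x i - a i)) kP.
    exists c'; split => //; apply: le_trans h2 _.
    under eq_bigr do rewrite exprMn; rewrite -mulr_sumr sum_basis_sqr.
    by rewrite mulr1 exprMn mulrC [t * _]mulrC mulrC.
  have := integrates_sum (index_enum 'I_n) (P := xpredT) (fun i _ => (c'P i).1).
  move=> [_ ->]; rewrite lee_fin; apply: ler_sum => i _.
  by rewrite sum_basis; exact: (c'P i).2.
move=> c' /(integrates_unique cP) -> /andP[_ h]; apply: le_trans h _.
rewrite big_split/= sumr_const card_ord -[_ *+ n]mulr_natl lerD2r -mulr_sumr.
rewrite ler_wpM2l ?sqr_ge0//; apply: ler_sum => i _.
by rewrite qform_basis sum_basis subrr expr0n addr0.
Qed.

(** The trace is at most the posterior mean of y = |x - th/t|^2, and by convexity its cube is at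
    most that of y^3, a sixth moment of the noise divided by t^6. The bound involves only t and n,
    whence its uniformity along the iteration. *)
Lemma posterior_tr_Cov_cube : exists2 c,
  integrates m (fun p => \tr (Cov (post p)) ^+ 3) c &
  c <= t ^- 6 * (n%:R ^+ 2 * (n%:R * (1440 * expR (t / 2)))).
Proof.
have [k kP] := observation_exists wP.
pose y (z : T * n.-tuple R) := \sum_i (tnth z.2 i - t^-1 * th z.1 i) ^+ 2.
have y0 z : 0 <= y z by apply: sumr_ge0 => i _; exact: sqr_ge0.
have yE x p : y (p, x) = t ^- 2 * \sum_i noise th t (basis R i) x p ^+ 2.
  rewrite mulr_sumr; apply: eq_bigr => i _ /=.
  by rewrite noise_basis; field; rewrite gt_eqF.
have my : measurable_fun setT y.
  apply: measurable_sum => i; apply: measurable_funX; apply: measurable_funB.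
    exact: measurableT_comp (mx i) measurable_snd.
  by apply: measurable_funM => //; exact: measurableT_comp (mth i) measurable_fst.
have [] := @posterior_le k (fun p => \tr (Cov (post p)) ^+ 3) (fun z => y z ^+ 3)
  _ _ kP _ _ _ _ _ _ (integrates_cst (t ^- 6 * (n%:R ^+ 2 * (n%:R * (1440 * expR (t / 2)))))
    (probability_setT mu)).
- exact: measurable_funX measurable_tr_Cov.
- by move=> p; exact: exprn_ge0.
- exact: measurable_funX.
- by move=> z; exact: exprn_ge0.
- move=> p; have [c' cP' cle] := integrates_posterior_dist p (fun i => t^-1 * th p i).
  set q := \tr _ in cle *; have q0 : 0 <= q by exact: tr0.
  have H := integratesB (integratesZ (3 * q ^+ 2) cP') (integrates_cst (2 * q ^+ 3) (post1 p)).
  (* Jensen's inequality for the cube by its tangent line at q, evaluated at the posterior mean c'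
     >= q of y. *)
  apply: (@le_trans _ _ (3 * q ^+ 2 * c' - 2 * q ^+ 3)%:E).
    rewrite lee_fin; have : 0 <= 3 * q ^+ 2 * (c' - q).
      by rewrite mulr_ge0 ?subr_ge0// mulr_ge0// sqr_ge0.
    by lra.
  apply: le_post_integral H _.
  + by apply: measurable_funX; exact: (measurableT_comp my (measurable_pair1 p)).
  + by move=> x; exact: exprn_ge0.
  + move=> x; rewrite -/(y (p, x)) -subr_ge0.
    rewrite (_ : _ - _ = (y (p, x) - q) ^+ 2 * (y (p, x) + 2 * q)); last by rewrite /y/=; ring.
    by rewrite mulr_ge0 ?sqr_ge0// addr_ge0// mulr_ge0.
- move=> x; have /choice[c' c'P] i : exists c', integrates (k x)
      (fun p => noise th t (basis R i) x p ^+ 6) c' /\ c' <= 1440 * expR (t / 2).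
    have [c' h1 h2] := noise_sixth gaP kP (basis R i) x; exists c'; split => //.
    by rewrite sum_basis_sqr mulr1 in h2.
  have H := integratesZ (t ^- 6 * n%:R ^+ 2)
    (integrates_sum (index_enum 'I_n) (P := xpredT) (fun i _ => (c'P i).1)).
  apply: (@le_trans _ _ (t ^- 6 * n%:R ^+ 2 * \sum_i c' i)%:E); last first.
    rewrite lee_fin -mulrA ler_wpM2l ?invr_ge0 ?exprn_ge0 ?(ltW t0)//.
    rewrite ler_wpM2l ?sqr_ge0//.
    apply: (@le_trans _ _ (\sum_(i < n) 1440 * expR (t / 2))).
      by apply: ler_sum => i _; exact: (c'P i).2.
    by rewrite sumr_const card_ord -[_ *+ n]mulr_natl.
  rewrite -H.2; apply: ge0_le_integral => //.
  + by move=> p _; rewrite lee_fin exprn_ge0.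
  + apply/measurable_EFinP; apply: measurable_funX.
    exact: (measurableT_comp my (measurable_pair2 x)).
  + by apply/measurable_EFinP; exact: integrates_measurable H.
  + move=> p _; rewrite lee_fin yE exprMn exprVn -exprM -mulrA.
    rewrite ler_wpM2l ?invr_ge0 ?exprn_ge0 ?(ltW t0)//.
    apply: le_trans (sum_cube_le _) _ => [i|]; first exact: sqr_ge0.
    by rewrite ler_wpM2l ?sqr_ge0//; apply: ler_sum => i _; rewrite -exprM.
by move=> c cP /andP[_ cle]; exists c.
Qed.

End gaussian_posterior.

(** * Decrease of the mean square error *)

Section gaussian_step.
Context (R : realType) (n : nat) (mu : probability (n.-tuple R) R).
Hypothesis muC : has_cov mu.
Context d1 (T1 : measurableType d1) (ga : probability T1 R) (th : T1 -> 'I_n -> R) (t : R).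
Hypotheses (t0 : 0 < t) (gaP : gaussian t ga th).
Context d2 (T2 : measurableType d2) (et : probability T2 R) (xi : T2 -> 'I_n -> R) (h : R).
Hypotheses (h0 : 0 < h) (etP : gaussian h et xi).

Let th' (p : T1 * T2) i := th p.1 i + xi p.2 i.

Let th0 : 0 < t + h. Proof. exact: addr_gt0. Qed.

Let gaP' : gaussian (t + h) (ga \x et)%E th' := gaussian_prod gaP etP.

Variables (m : probability T1 R) (post : R.-pker T1 ~> (n.-tuple R)).
Hypothesis pP : is_posterior ga mu (gaussian_weight th t) m post.
Variables (m' : probability (T1 * T2)%type R) (post' : R.-pker (T1 * T2)%type ~> (n.-tuple R)).
Hypothesis pP' : is_posterior (ga \x et)%E mu (gaussian_weight th' (t + h)) m' post'.

Let C p := Cov (post p).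
Let a p i := mean (post p) i 0.

(* Estimator of the signal from both observations: the posterior mean given
   the first one, corrected linearly by the second one with gain C. *)
Let b (z : T1 * T2) i := a z.1 i + \sum_j C z.1 i j * (xi z.2 j - h * a z.1 j).

(** Row [i] of Id - h C. The error of the estimator [b] is (Id - h C)(x - a), whose coordinates are
    [al], minus C applied to the noise of the second observation. *)
Let u p i j := basis R i j - h * C p i j.

Let al p (x : n.-tuple R) i := \sum_j u p i j * tnth x j - \sum_j u p i j * a p j.

Let bE p q x i : tnth x i - b (p, q) i = al p x i - noise xi h (C p i) x q.
Proof.
have S (f : 'I_n -> R) : \sum_j u p i j * f j = f i - h * \sum_j C p i j * f j.
  rewrite -[f i in RHS](sum_basis i f) mulr_sumr -sumrB; apply: eq_bigr => j _.
  by rewrite /u mulrBl mulrA.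
rewrite /al !S /b /noise /=.
under eq_bigr do rewrite mulrBr (mulrCA _ h).
under [X in _ = _ - X]eq_bigr do rewrite mulrBr (mulrCA _ h).
by rewrite !sumrB -!mulr_sumr; ring.
Qed.

(** Bound on the squared error of [b] averaged over the second observation, with the signal and the
    first observation fixed. *)
Let H (z : T1 * n.-tuple R) := \sum_i (al z.1 z.2 i ^+ 2 + h * \sum_j C z.1 i j ^+ 2).

Let mx i : measurable_fun setT (fun x : n.-tuple R => tnth x i).
Proof. exact: measurable_tnth. Qed.

Let mC i j : measurable_fun setT (fun p => C p i j).
Proof. exact: measurable_Cov. Qed.

Let ma i : measurable_fun setT (fun p => a p i).
Proof. exact: measurable_mean. Qed.

Let mH : measurable_fun setT H.
Proof.
have mC1 i j : measurable_fun setT (fun z : T1 * n.-tuple R => C z.1 i j).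
  exact: (measurableT_comp (mC i j) measurable_fst).
have mu1 i j : measurable_fun setT (fun z : T1 * n.-tuple R => u z.1 i j).
  by apply: measurable_funB => //; exact: measurable_funM.
apply: measurable_sum => i; apply: measurable_funD.
  apply: measurable_funX; apply: measurable_funB; apply: measurable_sum => j;
    apply: measurable_funM => //.
    exact: measurableT_comp (mx j) measurable_snd.
  exact: (measurableT_comp (ma j) measurable_fst).
apply: measurable_funM => //; apply: measurable_sum => j.
exact: measurable_funX.
Qed.

Let H0 z : 0 <= H z.
Proof.
apply: sumr_ge0 => i _; rewrite addr_ge0 ?sqr_ge0// mulr_ge0 ?(ltW h0)// sumr_ge0// => j _.
exact: sqr_ge0.
Qed.

Let mb i : measurable_fun setT (fun z => b z i).
Proof.
apply: measurable_funD; first exact: (measurableT_comp (ma i) measurable_fst).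
apply: measurable_sum => j; apply: measurable_funM.
  exact: (measurableT_comp (mC i j) measurable_fst).
apply: measurable_funB; first exact: (measurableT_comp (etP.1 j) measurable_snd).
by apply: measurable_funM => //; exact: (measurableT_comp (ma j) measurable_fst).
Qed.

Let G (z : T1 * T2 * n.-tuple R) := \sum_i (tnth z.2 i - b z.1 i) ^+ 2.

Let mG : measurable_fun setT G.
Proof.
apply: measurable_sum => i; apply: measurable_funX; apply: measurable_funB.
  exact: measurableT_comp (mx i) measurable_snd.
exact: (measurableT_comp (mb i) measurable_fst).
Qed.

Let G0 z : 0 <= G z.
Proof. by apply: sumr_ge0 => i _; exact: sqr_ge0. Qed.

Let inner (k : R.-pker (n.-tuple R) ~> T2) p x :
  (forall x, is_density et (k x) ((gaussian_weight xi h) ^~ x)) ->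
  (\int[k x]_q (G ((p, q), x))%:E <= (H (p, x))%:E)%E.
Proof.
move=> kP.
have /choice[c cP] i : exists c, integrates (k x)
    (fun q => (al p x i - noise xi h (C p i) x q) ^+ 2) c /\
    c <= al p x i ^+ 2 + h * \sum_j C p i j ^+ 2.
  by have [c ? ?] := noise_affine_sqr h0 etP (C p i) x (al p x i) kP; exists c.
have [_ E] := integrates_sum (index_enum 'I_n) (P := xpredT) (fun i _ => (cP i).1).
rewrite (eq_integral (fun q =>
    (\sum_i (al p x i - noise xi h (C p i) x q) ^+ 2)%:E)); last first.
  by move=> q _; congr _%:E; apply: eq_bigr => i _; rewrite -bE.
by rewrite E lee_fin; apply: ler_sum => i _; exact: (cP i).2.
Qed.

(** Given the signal the two observations are independent: the weight at time t + h of the summed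
    vector is the product of the weights at times t and h. *)
Let outer (k' : R.-pker (n.-tuple R) ~> (T1 * T2)%type)
    (k : R.-pker (n.-tuple R) ~> T1) (k2 : R.-pker (n.-tuple R) ~> T2) x :
  (forall x, is_density (ga \x et)%E (k' x) ((gaussian_weight th' (t + h)) ^~ x)) ->
  (forall x, is_density ga (k x) ((gaussian_weight th t) ^~ x)) ->
  (forall x, is_density et (k2 x) ((gaussian_weight xi h) ^~ x)) ->
  (\int[k' x]_z (G (z, x))%:E <= \int[k x]_p (H (p, x))%:E)%E.
Proof.
move=> k'P kP k2P.
have mGx : measurable_fun setT (fun z => (G (z, x))%:E).
  by apply/measurable_EFinP; exact: (measurableT_comp mG (measurable_pair2 x)).
have mHx : measurable_fun setT (fun p => (H (p, x))%:E).
  by apply/measurable_EFinP; exact: (measurableT_comp mH (measurable_pair2 x)).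
have [mw _ _] := k'P x; have [mw1 _ _] := kP x; have [mw2 _ _] := k2P x.
have mwE : measurable_fun setT (EFin \o (gaussian_weight th' (t + h) ^~ x)).
  exact/measurable_EFinP.
have mw1E : measurable_fun setT (EFin \o (gaussian_weight th t ^~ x)).
  exact/measurable_EFinP.
have mw2E : measurable_fun setT (EFin \o (gaussian_weight xi h ^~ x)).
  exact/measurable_EFinP.
rewrite (ge0_integral_density (k'P x))//; last by move=> z; rewrite lee_fin.
rewrite (ge0_integral_density (kP x))//; last by move=> z; rewrite lee_fin.
rewrite fubini_tonelli1//; last 2 first.
- exact: emeasurable_funM.
- by move=> z; rewrite mule_ge0// lee_fin// expR_ge0.
apply: ge0_le_integral => //.
- move=> p _; apply: integral_ge0 => q _.
  by rewrite mule_ge0// lee_fin// expR_ge0.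
- apply: (@measurable_fun_fubini_tonelli_F _ _ _ _ _ et
    (fun z => (G (z, x))%:E * (gaussian_weight th' (t + h) z x)%:E)%E).
    exact: emeasurable_funM.
  by move=> z; rewrite mule_ge0// lee_fin// expR_ge0.
- exact: emeasurable_funM.
move=> p _.
have mGp : measurable_fun setT (fun q => (G ((p, q), x))%:E).
  exact: (measurableT_comp mGx (measurable_pair1 p)).
have wE q : gaussian_weight th' (t + h) (p, q) x =
    gaussian_weight xi h q x * gaussian_weight th t p x.
  rewrite /gaussian_weight -expRD; congr expR.
  rewrite (_ : \sum_i th' (p, q) i * tnth x i =
    \sum_i th p i * tnth x i + \sum_i xi q i * tnth x i); first by ring.
  by rewrite -big_split/=; apply: eq_bigr => i _; rewrite /th' mulrDl.
rewrite /fubini_F; under eq_integral do rewrite wE EFinM muleA.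
rewrite ge0_integralZr//; last 3 first.
- exact: emeasurable_funM.
- by move=> q _; rewrite mule_ge0// lee_fin// expR_ge0.
- by rewrite lee_fin expR_ge0.
rewrite lee_wpmul2r ?lee_fin ?expR_ge0//.
by rewrite -(ge0_integral_density (k2P x))//; [exact: inner|move=> q; rewrite lee_fin].
Qed.

(** The shrinkage Id - h C lowers the error by 2 h Tr(C^2) to first order, and the noise passed
    through the gain C costs h Tr(C^2); the net gain is h Tr(C^2). *)
Lemma gaussian_step F F' S Q :
  integrates m (fun p => \tr (Cov (post p))) F ->
  integrates m (fun p => \tr (Cov (post p) *m Cov (post p))) S ->
  integrates m (fun p => \tr (Cov (post p)) ^+ 3) Q ->
  integrates m' (fun z => \tr (Cov (post' z))) F' ->
  F' <= F - h * S + h ^+ 2 * (n%:R ^+ 3 * Q).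
Proof.
move=> FP SP QP F'P.
have wP := gaussian_is_channel mu t0 gaP.
have wP' := gaussian_is_channel mu th0 gaP'.
have [k' k'P] := observation_exists wP'.
have [k kP] := observation_exists wP.
have [k2 k2P] := observation_exists (gaussian_is_channel mu h0 etP).
have [J JP] := joint_exists wP.
have FE := integratesD (integratesB FP (integratesZ h SP))
  (integratesZ (h ^+ 2) (integratesZ (n%:R ^+ 3) QP)).
rewrite -lee_fin -F'P.2 -FE.2.
apply: (@le_trans _ _ (\int[mu]_x \int[k' x]_z (G (z, x))%:E)%E).
  apply: (posterior_observation_le th0 gaP' pP' k'P) => //.
  - exact: measurable_tr_Cov.
  - move=> z; apply: psd_trace_ge0 => // v; apply: qform_Cov_ge0; first exact: prob_kernel.
    exact: (posterior_has_cov muC th0 gaP' pP' z).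
  - move=> z; have [c cP cle] := integrates_posterior_dist muC th0 gaP' pP' z (b z).
    by rewrite cP.2 lee_fin.
have mHE : measurable_fun setT (EFin \o H) by exact/measurable_EFinP.
apply: (@le_trans _ _ (\int[mu]_x \int[k x]_p (H (p, x))%:E)%E).
  apply: ge0_le_integral => //.
  - by move=> x _; apply: integral_ge0 => z _; rewrite lee_fin.
  - apply: (@measurable_kernel_integral _ _ _ _ _ k' (fun z => (G (z.2, z.1))%:E)).
    by apply/measurable_EFinP; exact: (measurableT_comp mG (@measurable_swap _ _ _ _)).
  - apply: (@measurable_kernel_integral _ _ _ _ _ k (fun z => (H (z.2, z.1))%:E)).
    exact: (measurableT_comp mHE (@measurable_swap _ _ _ _)).
  - by move=> x _; exact: outer.
rewrite -(observation_joint wP kP JP mHE); last by move=> z; rewrite lee_fin.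
rewrite (posterior_joint wP pP JP mHE); last by move=> z; rewrite lee_fin.
apply: ge0_le_integral => //.
- by move=> p _; apply: integral_ge0 => x _; rewrite lee_fin.
- exact: measurable_kernel_integral mHE.
- by apply/measurable_EFinP; exact: integrates_measurable FE.
move=> p _.
have pc := posterior_has_cov muC t0 gaP pP p.
have Cs i j : C p i j = C p j i by exact: Cov_sym.
have C0 v : 0 <= qform (C p) v by apply: qform_Cov_ge0 => //; exact: prob_kernel.
have [_ ->] := integrates_sum (index_enum 'I_n) (P := xpredT) (fun i _ =>
  integratesD (integrates_quadratic (u p i) (\sum_j u p i j * a p j) (prob_kernel p) pc)
    (integrates_cst (h * \sum_j C p i j ^+ 2) (prob_kernel p))).
rewrite lee_fin big_split/= -mulr_sumr -mxtrace_sqr// big_split/=.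
(* No bias term remains, since [al] is centered under the posterior. *)
rewrite [X in _ + X + _]big1 ?addr0; last by move=> i _; rewrite subrr expr0n.
have := psd_shrink_le Cs C0 (ltW h0); rewrite -/(C p); lra.
Qed.

End gaussian_step.

(** * Entropy loss *)

Lemma ln_ge_1BV (R : realType) (y : R) : 0 < y -> 1 - y^-1 <= ln y.
Proof. by move=> y0; have := expR_ge1Dx (- ln y); rewrite expRN lnK ?posrE//; lra. Qed.

Lemma integrates_ae_eq d (T : measurableType d) (R : realType)
    (mu : {measure set T -> \bar R}) (f g : T -> R) c :
  measurable_fun setT f -> {ae mu, forall x, g x = f x} ->
  integrates mu g c -> integrates mu f c.
Proof.
move=> mf gf gc; have mg := integrates_measurable gc.
have E : ae_eq mu setT (EFin \o g) (EFin \o f).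
  by apply: filterS gf => x /= -> _.
have mfE : measurable_fun setT (EFin \o f) by exact/measurable_EFinP.
have mgE : measurable_fun setT (EFin \o g) by exact/measurable_EFinP.
split; last by case: gc => _ <-; rewrite (ae_eq_integral _ _ _ _ _ E).
apply/integrableP; split => //; case: gc => /integrableP[_ goo] _.
rewrite (_ : \int[mu]_x _ = \int[mu]_x `|(EFin \o g) x|)%E//.
apply: ae_eq_integral => //; try exact: measurableT_comp.
by apply: filterS gf => x /= -> _.
Qed.

Lemma integrates_between d (T : measurableType d) (R : realType)
    (mu : {measure set T -> \bar R}) (l f g : T -> R) cl cg :
  measurable_fun setT f -> integrates mu l cl -> integrates mu g cg ->
  (forall x, l x <= f x <= g x) -> integrates mu f (\int[mu]_x f x).
Proof.
move=> mf lc gc lfg.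
have ni h c : integrates mu h c -> integrates mu (fun x => `|h x|) (\int[mu]_x `|h x|).
  by move=> [hi _]; apply: integratesP; exact: (integrable_abse hi).
apply: (dominated_integrates mf _ (integratesD (ni _ _ lc) (ni _ _ gc))) => x.
have /andP[h1 h2] := lfg x; rewrite ler_norml; apply/andP; split.
  have := ler_norm (- l x); rewrite normrN; have := normr_ge0 (g x); lra.
have := ler_norm (g x); have := normr_ge0 (l x); lra.
Qed.

Section entropy_loss.
Context (R : realType) (n : nat) (mu : probability (n.-tuple R) R).
Variable nu : {measure set (n.-tuple R) -> \bar R}.
Hypotheses (muC : has_cov mu) (muH : has_entropy nu mu).
Context d (T : measurableType d) (ga : probability T R) (th : T -> 'I_n -> R) (t : R).
Hypotheses (t0 : 0 < t) (gaP : gaussian t ga th).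
Variables (m : probability T R) (post : R.-pker T ~> (n.-tuple R)).
Hypothesis pP : is_posterior ga mu (gaussian_weight th t) m post.

Local Notation w := (gaussian_weight th t).
Local Notation Z := (evidence mu w).

Let wP : channel ga mu w := gaussian_is_channel mu t0 gaP.

Let lw (p : T) (x : n.-tuple R) :=
  \sum_i th p i * tnth x i - t / 2 * \sum_i tnth x i ^+ 2.

Let lwE p x : ln (w p x) = lw p x. Proof. exact: expRK. Qed.

Let w0 p x : 0 < w p x. Proof. exact: expR_gt0. Qed.
Let Z0 p : 0 < Z p. Proof. exact: evidence_gt0 wP p. Qed.

Let mx i : measurable_fun setT (fun x : n.-tuple R => tnth x i).
Proof. exact: measurable_tnth. Qed.

Let a i := mean mu i 0.
Let M i := \int[mu]_x (tnth x i * tnth x i).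

Let trE : \tr (Cov mu) = \sum_i M i - \sum_i a i ^+ 2.
Proof. by rewrite -sumrB; apply: eq_bigr => i _; rewrite CovE expr2. Qed.

Section joint_moments.
Variables (k : R.-pker (n.-tuple R) ~> T) (J : probability (T * n.-tuple R)%type R).
Hypothesis kP : forall x, is_density ga (k x) (w ^~ x).
Hypothesis JP : is_density (ga \x mu)%E J (fun z => w z.1 z.2).

Let v i (z : T * n.-tuple R) := noise th t (basis R i) z.2 z.1.

Let mv i : measurable_fun setT (v i).
Proof. exact: (measurable_noise2 gaP _). Qed.

Let integrates_v2 i : exists c, integrates J (fun z => v i z ^+ 2) c.
Proof.
have mv2 : measurable_fun setT (fun z => v i z ^+ 2) by exact: measurable_funX.
have := @integrates_ge0_le _ _ _ J (fun z => v i z ^+ 2) t mv2 (fun z => sqr_ge0 _).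
case=> [|c cP _]; last by exists c.
rewrite (observation_joint wP kP JP); last 2 first.
- exact/measurable_EFinP.
- by move=> z; rewrite lee_fin sqr_ge0.
rewrite -(integrates_cst t (probability_setT mu)).2.
apply: ge0_le_integral => //.
- by move=> x _; apply: integral_ge0 => p _; rewrite lee_fin sqr_ge0.
- apply: (@measurable_kernel_integral _ _ _ _ _ k (fun z => (v i (z.2, z.1) ^+ 2)%:E)).
  apply/measurable_EFinP.
  exact: (measurableT_comp mv2 (@measurable_swap _ _ _ _)).
- move=> x _; have [c cP cle] := noise_sqr t0 gaP kP (basis R i) x.
  by rewrite cP.2 lee_fin (le_trans cle)// sum_basis_sqr mulr1.
Qed.

(** Given the signal the noise is centered, so it is uncorrelated with square integrable functions
    of the signal. *)
Lemma integrates_noise_signal i (g : n.-tuple R -> R) c2 : measurable_fun setT g ->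
  integrates mu (fun x => g x ^+ 2) c2 ->
  integrates J (fun z => v i z * g z.2) 0.
Proof.
move=> mg gP; have [c cP] := integrates_v2 i.
have hi : integrates J (fun z => v i z * g z.2) (\int[J]_z (v i z * g z.2)).
  apply: (dominated_integrates _ _ (integratesD cP (integrates_signal wP kP JP gP))).
    by apply: measurable_funM => //; exact: (measurableT_comp mg measurable_snd).
  move=> z; rewrite ler_norml.
  have := sqr_ge0 (v i z + g z.2); have := sqr_ge0 (v i z - g z.2).
  have := sqr_ge0 (v i z); have := sqr_ge0 (g z.2) => *; apply/andP; split; lra.
have := integrates_observation wP kP JP hi.
rewrite (_ : (fun x => _) = fun=> 0).
  by move/(integrates_unique (integrates0 mu)) => E; rewrite -E in hi.
apply/funext => x.
have := integratesZ (g x) (noise_mean t0 gaP kP (basis R i) x).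
rewrite mulr0 => H; apply: integratesE.
by apply: eq_integrates H => p; rewrite /v mulrC.
Qed.

Lemma integrates_obs i : integrates J (fun z => th z.1 i) (t * a i).
Proof.
have h1 : integrates J (fun z => v i z * 1) 0.
  apply: (@integrates_noise_signal i (fun=> 1) (1 ^+ 2)) => //.
  exact: integrates_cst (probability_setT mu).
have h2 := integratesZ t (integrates_signal wP kP JP (integratesP (muC.1 i))).
have := integratesD h1 h2; rewrite add0r /a mxE.
apply: eq_integrates => z.
by rewrite /v noise_basis; ring.
Qed.

(** Writing [th] as t x plus noise, the log weight is noise . x + (t/2) |x|^2, and the first term
    has mean zero. *)
Lemma integrates_log_weight :
  integrates J (fun z => lw z.1 z.2) (t / 2 * \sum_i M i).
Proof.
have h2 i : integrates mu (fun x => tnth x i ^+ 2) (M i).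
  by apply: eq_integrates (integratesP (muC.2 i i)) => x; rewrite expr2.
have h1 i := integrates_noise_signal i (mx i) (h2 i).
have := integratesD (integrates_sum (index_enum 'I_n) (P := xpredT) (fun i _ => h1 i))
  (integratesZ (t / 2) (integrates_signal wP kP JP
    (integrates_sum (index_enum 'I_n) (P := xpredT) (fun i _ => h2 i)))).
rewrite big1// add0r; apply: eq_integrates => z; rewrite /lw.
rewrite [X in _ = X - _](_ : _ = \sum_i v i z * tnth z.2 i + t * \sum_i tnth z.2 i ^+ 2).
  by field.
rewrite mulr_sumr -big_split/=; apply: eq_bigr => i _.
by rewrite /v noise_basis; ring.
Qed.

End joint_moments.

Let post1 p : post p setT = 1%E := prob_kernel p.

Let mlnZ : measurable_fun setT (fun p => ln (Z p)).
Proof. exact: (measurableT_comp (@measurable_ln R) (measurable_evidence wP)). Qed.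

Let Lw p := \int[post p]_x lw p x.

Let LwP p : integrates (post p) (lw p) (Lw p).
Proof.
have [c1 c2] := posterior_has_cov muC t0 gaP pP p.
have h1 := integrates_sum (index_enum 'I_n) (P := xpredT) (fun i _ =>
  integratesZ (th p i) (integratesP (c1 i))).
have h2 := integratesZ (t / 2) (integrates_sum (index_enum 'I_n) (P := xpredT) (fun i _ =>
  integratesP (c2 i i))).
have H := integratesB h1 h2.
have {}H : integrates (post p) (lw p) _ := H.
by rewrite /Lw (integratesE H).
Qed.

(** The difference is the relative entropy of [post p] with respect to mu. This upper bound serves
    for the integrability of ln Z. *)
Let lnZ_le p : ln (Z p) <= Lw p.
Proof.
have [_ /(_ p) dP] := pP.
have h1 : integrates (post p) (fun x => Z p / w p x) 1.
  have mf : measurable_fun setT (fun x => Z p / w p x).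
    apply: measurable_funM => //; apply: measurable_funV_gt0 => //.
    have [mw _ _ _] := wP; exact: (measurableT_comp mw (measurable_pair1 p)).
  apply/(integrates_density 1 dP mf).
  apply: eq_integrates (integrates_cst 1 (probability_setT mu)) => x.
  by field; rewrite !gt_eqF.
have := integratesD (integratesB (LwP p) (integrates_cst 1 (post1 p))) h1.
rewrite subrK => H; apply: le_integrates (integrates_cst (ln (Z p)) (post1 p)) H _ => x.
have := @ln_ge_1BV R (w p x / Z p) (divr_gt0 (w0 p x) (Z0 p)).
by rewrite ln_div ?posrE// lwE invf_div; lra.
Qed.

Let at_ : n.-tuple R := [tuple a i | i < n].

(** The weight at the mean [at_] of mu is the density of the Gaussian law centered at t [at_]. [B]
    bounds ln Z from below by ln y >= 1 - 1/y at y = Z p / w p at_. *)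
Let B p := lw p at_ + 1 - w p at_ / Z p.

Let lnZ_ge p : B p <= ln (Z p).
Proof.
have := @ln_ge_1BV R (Z p / w p at_) (divr_gt0 (Z0 p) (w0 p at_)).
by rewrite ln_div ?posrE// lwE invf_div /B; lra.
Qed.

(** Under [m] the ratio w p at_ / Z p has mean one and cancels the constant 1, while [th] has mean t
    [at_]. *)
Let BP : integrates m B (t / 2 * \sum_i a i ^+ 2).
Proof.
have [k kP] := observation_exists wP; have [J JP] := joint_exists wP.
have [mP _] := pP; have [mw _ wi w1] := wP.
have mwa : measurable_fun setT (fun p => w p at_).
  exact: (measurableT_comp mw (measurable_pair2 at_)).
have h1 : integrates m (fun p => w p at_ / Z p) 1.
  have mf : measurable_fun setT (fun p => w p at_ / Z p).
    by apply: measurable_funM => //; exact: measurable_funV_gt0 (measurable_evidence wP) Z0.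
  apply/(integrates_density 1 mP mf).
  have : integrates ga (fun p => w p at_) 1.
    split => //; apply/integrableP; split; first exact/measurable_EFinP.
    by under eq_integral do rewrite /= ger0_norm ?(ltW (w0 _ _))//; rewrite w1 ltry.
  by apply: eq_integrates => p; rewrite divfK// gt_eqF.
have hth i : integrates m (fun p => th p i) (t * a i).
  have := integrates_posterior wP pP JP (integrates_obs kP JP i).
  apply: eq_integrates => p /=.
  exact: integratesE (integrates_cst (th p i) (post1 p)).
have h2 : integrates m (fun p => lw p at_) (t / 2 * \sum_i a i ^+ 2).
  have := integratesB (integrates_sum (index_enum 'I_n) (P := xpredT) (fun i _ =>
    integratesZ (a i) (hth i))) (integrates_cst (t / 2 * \sum_i a i ^+ 2) (probability_setT m)).
  rewrite (_ : _ - _ = t / 2 * \sum_i a i ^+ 2); last first.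
    rewrite (_ : \sum_i a i * (t * a i) = t * \sum_i a i ^+ 2); first by field.
    by rewrite mulr_sumr; apply: eq_bigr => i _; ring.
  apply: eq_integrates => p; rewrite /lw; congr (_ - _ * _).
    by apply: eq_bigr => i _; rewrite tnth_mktuple mulrC.
  by apply: eq_bigr => i _; rewrite tnth_mktuple.
have := integratesB (integratesD h2 (integrates_cst 1 (probability_setT m))) h1.
by rewrite addrK.
Qed.

Let Lw_integrates : integrates m Lw (t / 2 * \sum_i M i).
Proof.
have [k kP] := observation_exists wP; have [J JP] := joint_exists wP.
exact: (integrates_posterior wP pP JP (integrates_log_weight kP JP)).
Qed.

Lemma posterior_entropy :
  {ae m, forall p, has_entropy nu (post p)} /\
  exists2 c, integrates m (fun p => entropy nu (post p)) c &
    entropy nu mu - c <= t / 2 * \tr (Cov mu).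
Proof.
have [k kP] := observation_exists wP; have [J JP] := joint_exists wP.
have [f fP lnf] := muH; have [mf f0 fE] := fP.
have [mw _ _ _] := wP.
pose g p x := f x * (w p x / Z p).
have gP p : is_density nu (post p) (g p) by exact: is_density_comp fP (pP.2 p).
have mlng : measurable_fun setT (fun z => ln (g z.1 z.2)).
  apply: (measurableT_comp (@measurable_ln R)); apply: measurable_funM.
    exact: (measurableT_comp mf measurable_snd).
  apply: measurable_funM => //.
  exact: (measurableT_comp (measurable_funV_gt0 (measurable_evidence wP) Z0) measurable_fst).
have EE p : entropy nu (post p) = - \int[post p]_x ln (g p x).
  by apply: entropyE => //; rewrite post1 ltry.
have mE : measurable_fun setT (fun p => entropy nu (post p)).
  under eq_fun do rewrite EE; apply: measurableT_comp => //.
  exact: (@measurable_kernel_Rintegral _ _ _ _ _ post _ mlng).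
have mf0 : measurable [set x | f x = 0].
  have -> : [set x | f x = 0] = setT `&` f @^-1` [set 0] by rewrite setTI.
  exact: mf.
have muf0 : mu [set x | f x = 0] = 0%E.
  by rewrite fE//; apply: integral0_eq => x ->.
(* Splitting the logarithm of [g p] into a sum requires f > 0. The posterior inherits this from mu,
   which gives no mass to the zeros of its own density. *)
have f_gt0 p : {ae post p, forall x, 0 < f x}.
  exists [set x | f x = 0]; split => //.
    by have [_ _ ->//] := pP.2 p; apply: null_set_integral => //;
      apply/measurable_EFinP; apply: measurable_funTS; have [] := pP.2 p.
  by move=> x /= /negP; rewrite lt0r f0 andbT negbK => /eqP.
have lnfP := integratesP lnf.
have lnfJ := integrates_signal wP kP JP lnfP.
have Lf := integrates_posterior wP pP JP lnfJ.
have key p : (post p).-integrable setT (fun x => (ln (f x))%:E) ->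
    integrates (post p) (fun x => ln (g p x)) (\int[post p]_x ln (f x) + Lw p - ln (Z p)).
  move=> fi; have H := integratesB (integratesD (integratesP fi) (LwP p))
    (integrates_cst (ln (Z p)) (post1 p)).
  apply: integrates_ae_eq H; first exact: (measurableT_comp mlng (measurable_pair1 p)).
  apply: filterS (f_gt0 p) => x fx.
  rewrite -lwE -addrA -ln_div ?posrE//.
  by rewrite -lnM// posrE divr_gt0.
have ai := ae_integrable_posterior wP pP JP lnfJ.
split.
  by apply: filterS ai => p /key [gi _]; exists (g p).
have lnZP := integrates_between mlnZ BP Lw_integrates
  (fun p => introT andP (conj (lnZ_ge p) (lnZ_le p))).
set z := Rintegral _ _ _ in lnZP.
have H := integratesZ (-1) (integratesB (integratesD Lf Lw_integrates) lnZP).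
eexists.
  apply: integrates_ae_eq H => //; apply: filterS ai => p /key /integratesE E.
  by rewrite EE E mulN1r.
have muoo : (mu setT < +oo)%E by rewrite (probability_setT mu) ltry.
rewrite (entropyE muoo fP).
(* The contributions of ln f cancel, leaving the mean of [Lw] minus that of ln Z. *)
have := le_integrates BP lnZP lnZ_ge; rewrite trE -/z.
by set c := Rintegral _ _ _; lra.
Qed.

End entropy_loss.

(** * Choice of the localization time *)

Section stopping_time.
Context (R : realType) (n : nat) (mu : probability (n.-tuple R) R).
Hypothesis muC : has_cov mu.

Definition localized t d (T : measurableType d) (ga : probability T R)
    (th : T -> 'I_n -> R) (m : probability T R) (post : R.-pker T ~> (n.-tuple R)) :=
  gaussian t ga th /\ is_posterior ga mu (gaussian_weight th t) m post.

Lemma localized_exists t d (T : measurableType d) (ga : probability T R)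
    (th : T -> 'I_n -> R) : 0 < t -> gaussian t ga th ->
  exists m post, localized t ga th m post.
Proof.
move=> t0 gaP; have [m [post pP]] := posterior_exists (gaussian_is_channel mu t0 gaP).
by exists m, post.
Qed.

Section integrals.
Context (t : R) d (T : measurableType d) (ga : probability T R) (th : T -> 'I_n -> R)
  (m : probability T R) (post : R.-pker T ~> (n.-tuple R)).
Hypotheses (t0 : 0 < t) (L : localized t ga th m post).

Let C0 p u : 0 <= qform (Cov (post p)) u.
Proof.
apply: qform_Cov_ge0; first exact: prob_kernel.
by case: L => gaP pP; exact: (posterior_has_cov muC t0 gaP pP p).
Qed.

Lemma tr_Cov_ge0 p : 0 <= \tr (Cov (post p)).
Proof. exact: psd_trace_ge0. Qed.

Lemma integrates_tr_Cov_sqr :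
  exists c, integrates m (fun p => \tr (Cov (post p) *m Cov (post p))) c.
Proof.
case: L => gaP pP; have [q qP _] := posterior_tr_Cov_cube muC t0 gaP pP.
have H := integratesZ (n%:R ^+ 2) (integratesD (integrates_cst 1 (probability_setT m)) qP).
have Cs p i j : Cov (post p) i j = Cov (post p) j i by exact: Cov_sym.
(* Domination by n^2 (1 + q^3), where q is the trace: q^2 <= 1 if q <= 1, and q^2 <= q^3
   otherwise. *)
eexists; apply: (dominated_integrates _ _ H); first exact: measurable_tr_Cov_sqr.
move=> p; rewrite ger0_norm; last exact: psd_trace_sqr_ge0.
apply: le_trans (psd_trace_sqr_le (Cs p) (C0 p)) _.
rewrite ler_wpM2l ?sqr_ge0//; have tr0 := tr_Cov_ge0 p.
set q' := \tr _ in tr0 *.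
case: (leP q' 1) => [q1|/ltW q1].
  apply: (@le_trans _ _ 1); first by rewrite expr_le1.
  by rewrite lerDl exprn_ge0.
apply: (@le_trans _ _ (q' ^+ 3)); last by rewrite lerDr.
by rewrite ler_weXn2l.
Qed.

End integrals.

Local Notation V := (\tr (Cov mu)).

Let V0 : 0 <= V.
Proof.
apply: psd_trace_ge0 => u.
by apply: qform_Cov_ge0 => //; exact: probability_setT.
Qed.

Variable eps : R.
Hypothesis eps0 : 0 < eps.

(** The h^2 constant of [gaussian_step], with the cubic moment bounded uniformly: t >= eps in the
    power, t / 2 <= eps in the exponential. *)
Let D := n%:R ^+ 3 * (eps ^- 6 * (n%:R ^+ 2 * (n%:R * (1440 * expR eps)))).

Let D0 : 0 <= D.
Proof.
apply: mulr_ge0; first exact: exprn_ge0.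
apply: mulr_ge0; first by rewrite invr_ge0 exprn_ge0// ltW.
apply: mulr_ge0; first exact: exprn_ge0.
apply: mulr_ge0; first exact: ler0n.
  apply: mulr_ge0; [exact: ler0n|exact: expR_ge0].
Qed.

Lemma localized_step t h d (T : measurableType d) (ga : probability T R)
    (th : T -> 'I_n -> R) m post F S :
  eps <= t <= 2 * eps -> 0 < h -> localized t ga th m post ->
  integrates m (fun p => \tr (Cov (post p))) F ->
  integrates m (fun p => \tr (Cov (post p) *m Cov (post p))) S ->
  exists d' (T' : measurableType d') (ga' : probability T' R) th' m' post' F',
    [/\ localized (t + h) ga' th' m' post',
      integrates m' (fun p => \tr (Cov (post' p))) F' &
      F' <= F - h * S + h ^+ 2 * D].
Proof.
move=> /andP[et te] h0 [gaP pP] FP SP.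
have t0 : 0 < t by apply: lt_le_trans et.
have [d2 [T2 [et2 [xi etP]]]] := gaussian_exists n h0.
have th0 : 0 < t + h by apply: addr_gt0.
have gaP' := gaussian_prod gaP etP.
have [m' [post' L']] := localized_exists th0 gaP'.
have [F' F'P] := integrates_tr_Cov muC th0 gaP' L'.2.
have [Q QP Qle] := posterior_tr_Cov_cube muC t0 gaP pP.
exists _, _, (ga \x et2)%E, (fun p i => th p.1 i + xi p.2 i), m', post', F'; split => //.
apply: le_trans (gaussian_step muC t0 gaP h0 etP pP L'.2 FP SP QP F'P) _.
rewrite lerD2l ler_wpM2l ?sqr_ge0// ler_wpM2l ?exprn_ge0//.
apply: le_trans Qle _; apply: ler_pM.
- by rewrite invr_ge0 exprn_ge0// ltW.
- apply: mulr_ge0; first exact: exprn_ge0.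
  apply: mulr_ge0; first exact: ler0n.
  apply: mulr_ge0; [exact: ler0n|exact: expR_ge0].
- rewrite lef_pV2 ?posrE ?exprn_gt0//.
  by rewrite lerXn2r// nnegrE ltW.
- apply: ler_wpM2l; first exact: exprn_ge0.
  apply: ler_wpM2l; first exact: ler0n.
  apply: ler_wpM2l; first exact: ler0n.
  by rewrite ler_expR; lra.
Qed.

Lemma localization_time : exists t d (T : measurableType d) (ga : probability T R) th m post,
  [/\ eps <= t <= 2 * eps, localized t ga th m post &
    exists2 c, integrates m (fun p => \tr (Cov (post p) *m Cov (post p))) c & c <= V / eps].
Proof.
apply: contrapT => noloc.
have big t d (T : measurableType d) (ga : probability T R) th m post S :
    eps <= t <= 2 * eps -> localized t ga th m post ->
    integrates m (fun p => \tr (Cov (post p) *m Cov (post p))) S -> V / eps < S.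
  move=> ht L SP; rewrite ltNge; apply/negP => SV; apply: noloc.
  by exists t, d, T, ga, th, m, post; split => //; exists S.
have he : eps <= eps <= 2 * eps by rewrite lexx/= mulr_natl mulr2n lerDl ltW.
have [d [T [ga [th gaP]]]] := gaussian_exists n eps0.
have [m [post L]] := localized_exists eps0 gaP.
have [F FP] := integrates_tr_Cov muC eps0 gaP L.2.
have [S SP] := integrates_tr_Cov_sqr eps0 L.
have Fpos t d' (T' : measurableType d') (ga' : probability T' R) th' m' post' F' :
    0 < t -> localized t ga' th' m' post' ->
    integrates m' (fun p => \tr (Cov (post' p))) F' -> 0 <= F'.
  move=> t0' L' F'P; apply: le_integrates (integrates0 m') F'P _ => p.
  exact: tr_Cov_ge0 L' p.
have Fle s := posterior_tr_Cov_le muC eps0 gaP L.2 s FP.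
(* If V = 0, then F <= 0 < S, and the step h = S / (D + 1) gives F' <= -h S + h^2 D = -h^2 < 0. *)
have [V_eq0|Vn0] := eqVneq V 0.
  have S0 : 0 < S by have := big _ _ _ _ _ _ _ _ he L SP; rewrite V_eq0 mul0r.
  have h0 : 0 < S / (D + 1) by rewrite divr_gt0// ltr_wpDl.
  have [d' [T' [ga' [th' [m' [post' [F' [L' F'P F'le]]]]]]]] :=
    localized_step he h0 L FP SP.
  have F'0 := Fpos _ _ _ _ _ _ _ _ (addr_gt0 eps0 h0) L' F'P.
  have := Fle 0; rewrite V_eq0 mulr0 expr0n/= mul0r mulr0 addr0 => F0.
  set h := S / (D + 1) in h0 F'le; have hE : h * (D + 1) = S by rewrite /h divfK// gt_eqF// ltr_wpDl.
  have : 0 <= - h * S + h ^+ 2 * D by lra.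
  have h2 : 0 < h ^+ 2 by rewrite exprn_gt0.
  by rewrite -hE; lra.
have Vp : 0 < V by rewrite lt0r Vn0.
(* The minimiser of (1 - s eps)^2 V + n s^2 eps, whose minimum is V - s eps V. *)
pose s := V / (eps * V + n%:R).
have den0 : 0 < eps * V + n%:R by rewrite ltr_pwDl// mulr_gt0.
pose de := s * eps * V.
have de0 : 0 < de by rewrite !mulr_gt0// invr_gt0.
have Fde : F <= V - de.
  apply: le_trans (Fle s) _.
  have sE : s * (eps * V + n%:R) = V by rewrite /s divfK// gt_eqF.
  rewrite [leLHS](_ : _ = V - 2 * s * eps * V + s * eps * (s * (eps * V + n%:R))); last by ring.
  by rewrite sE /de; lra.
(* Enough steps for the accumulated error N h^2 D = eps^2 D / N to stay below the gap [de]. *)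
pose N := (Num.truncn (eps ^+ 2 * D / de)).+1.
have NP : eps ^+ 2 * D / de < N%:R by exact: Num.Theory.truncnS_gt.
have N0 : 0 < N%:R :> R by rewrite ltr0n.
pose h := eps / N%:R.
have h0 : 0 < h by rewrite divr_gt0.
have hN : N%:R * h = eps by rewrite /h mulrC divfK// gt_eqF.
pose K := V / eps.
have H k : (k <= N)%N -> exists d' (T' : measurableType d') (ga' : probability T' R) th' m' post' F',
    [/\ localized (eps + k%:R * h) ga' th' m' post',
      integrates m' (fun p => \tr (Cov (post' p))) F' &
      F' <= V - de - k%:R * (h * (K - h * D))].
  elim: k => [_|k IH kN].
    by exists d, T, ga, th, m, post, F; rewrite !mul0r addr0 subr0.
  have [d' [T' [ga' [th' [m' [post' [F' [L' F'P F'le]]]]]]]] := IH (ltnW kN).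
  have ht : eps <= eps + k%:R * h <= 2 * eps.
    rewrite lerDl mulr_ge0 ?(ltW h0)//= (_ : 2 * eps = eps + eps); last by ring.
    rewrite lerD2l -[leRHS]hN.
    by rewrite ler_wpM2r ?(ltW h0)// ler_nat ltnW.
  have t0 : 0 < eps + k%:R * h by case/andP: ht => + _; apply: lt_le_trans.
  have [S' S'P] := integrates_tr_Cov_sqr t0 L'.
  have [d2 [T2 [ga2 [th2 [m2 [post2 [F2 [L2 F2P F2le]]]]]]]] :=
    localized_step ht h0 L' F'P S'P.
  exists d2, T2, ga2, th2, m2, post2, F2.
  rewrite (_ : k.+1%:R * h = k%:R * h + h); last by rewrite -natr1 mulrDl mul1r.
  rewrite addrA; split => //.
  rewrite -natr1; have := big _ _ _ _ _ _ _ _ ht L' S'P; rewrite -/K => KS.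
  have : h * K <= h * S' by rewrite ler_wpM2l// ltW.
  lra.
have [d' [T' [ga' [th' [m' [post' [F' [L' F'P F'le]]]]]]]] := H N (leqnn N).
have t0 : 0 < eps + N%:R * h by rewrite addr_gt0// mulr_gt0.
have := Fpos _ _ _ _ _ _ _ _ t0 L' F'P.
move: F'le; rewrite mulrA hN.
(* After N steps the main terms cancel, V - eps K = 0, and the bound on F' is eps h D - de < 0. *)
have KE : eps * K = V by rewrite /K mulrC divfK// gt_eqF.
have : eps * h * D < de.
  move: NP; rewrite ltr_pdivrMr// => NP.
  rewrite -(ltr_pM2l N0) [ltLHS](_ : _ = eps * (N%:R * h) * D); last by ring.
  by rewrite hN -expr2.
lra.
Qed.

End stopping_time.

Unset Implicit Arguments.

Theorem corollary3 (R : realType) (n : nat)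
    (nu : {measure set (n.-tuple R) -> \bar R})
    (mu : probability (n.-tuple R) R) (eps : R) :
  has_cov mu -> has_entropy nu mu -> 0 < eps ->
  exists (d : measure_display) (I : measurableType d) (m : probability I R)
         (mu_ : R.-pker I ~> (n.-tuple R)),
    (forall A, measurable A -> mu A = (\int[m]_theta mu_ theta A)%E) /\
    {ae m, forall theta, has_cov (mu_ theta) /\ has_entropy nu (mu_ theta)} /\
    (m.-integrable setT (fun theta => (entropy nu (mu_ theta))%:E) /\
     entropy nu mu - \int[m]_theta entropy nu (mu_ theta)
       <= \tr (Cov mu) * eps) /\
    ((forall i j, m.-integrable setT (fun theta => (Cov (mu_ theta) i j)%:E)) /\
     loewner_le (\matrix_(i, j) \int[m]_theta Cov (mu_ theta) i j)
       (eps^-1)%:M) /\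
    (m.-integrable setT
       (fun theta => (\tr (Cov (mu_ theta) *m Cov (mu_ theta)))%:E) /\
     \int[m]_theta \tr (Cov (mu_ theta) *m Cov (mu_ theta))
       <= \tr (Cov mu) / eps).
Proof.
move=> muC muH eps0.
have [t [d [T [ga [th [m [post [ht [gaP pP] [c cP cle]]]]]]]]] :=
  localization_time muC eps0.
have /andP[et te] := ht; have t0 : 0 < t by apply: lt_le_trans et.
have wP := gaussian_is_channel mu t0 gaP.
have [k kP] := observation_exists wP; have [J JP] := joint_exists wP.
have [aeH [e eP ele]] := posterior_entropy muC muH t0 gaP pP.
have V0 : 0 <= \tr (Cov mu).
  apply: psd_trace_ge0 => u.
  by apply: qform_Cov_ge0 => //; exact: probability_setT.
exists d, T, m, post; split; first exact: (posterior_mixture wP pP kP JP).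
split.
  by apply: filterS aeH => p hp; split => //; exact: (posterior_has_cov muC t0 gaP pP p).
split.
  split; first by case: eP.
  (* t / 2 <= eps. *)
  by rewrite (integratesE eP); apply: le_trans ele _; nra.
split; last by split; [case: cP|rewrite (integratesE cP)].
have Ci i j : integrates m (fun p => Cov (post p) i j) (\int[m]_p Cov (post p) i j).
  by have [c' c'P] := integrates_Cov muC t0 gaP pP i j; rewrite (integratesE c'P).
split; first by move=> i j; case: (Ci i j).
set E := \matrix_(i, j) _; split.
  apply/matrixP => i j; rewrite !mxE [i == j]eq_sym; congr (_ - _).
  by congr Rintegral; apply/funext => p; rewrite Cov_sym.
move=> u; have [q qP qle] := posterior_Cov_le muC t0 gaP pP (fun i => u i 0).
(* The quadratic form of the averaged matrix is the average of the quadratic forms. *)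
have qE : q = qform E (fun i => u i 0).
  apply: integrates_unique qP _.
  apply: integrates_sum => i _; apply: integrates_sum => j _.
  by rewrite mxE; exact: integratesZ.
have -> : (u^T *m (eps^-1%:M - E) *m u) 0 0 =
    eps^-1 * (\sum_i u i 0 ^+ 2) - qform E (fun i => u i 0).
  rewrite mulmxBr mulmxBl mxE [X in _ + X]mxE; congr (_ - _).
    rewrite mul_mx_scalar -scalemxAl !mxE; congr (_ * _).
    by apply: eq_bigr => i _; rewrite mxE expr2.
  rewrite mxE; under eq_bigr do rewrite mxE mulr_suml.
  rewrite exchange_big; apply: eq_bigr => i _; apply: eq_bigr => j _.
  by rewrite !mxE; ring.
rewrite -qE subr_ge0; apply: le_trans qle _.
by rewrite ler_wpM2r ?sumr_ge0// => [i _|]; [exact: sqr_ge0|rewrite lef_pV2 ?posrE].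
Qed.
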